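(* There is an absolute constant $c>0$ (independent of $n$ and $K$) such that for every $n\ge 1$ and every convex body $K\subset\mathbb{R}^n$ with barycenter at the origin there is a simplex $S\subset K$ with barycenter at the origin such that $$\left(\frac{\mathrm{vol}(S)}{\mathrm{vol}(K)}\right)^{1/n}\ge \frac{c}{\sqrt{n}}.$$
   Context: A convex body in $\mathbb{R}^n$ is a compact convex set with non-empty interior. $\mathrm{vol}$ denotes Lebesgue measure in $\mathbb{R}^n$. A simplex in $\mathbb{R}^n$ always means an $n$-simplex, i.e. the convex hull of $n+1$ affinely independent points of $\mathbb{R}^n$. The barycenter of a convex body $K$ is $\mathrm{bar}(K)=\frac{1}{\mathrm{vol}(K)}\int_K x\,dx$. *)

(* Defs.v *)
From HB Require Import structures.
From mathcomp Require Import all_boot all_order all_algebra.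
From mathcomp Require Import all_classical all_reals all_analysis.

Set Implicit Arguments.
Unset Strict Implicit.
Unset Printing Implicit Defensive.

Import Order.TTheory GRing.Theory Num.Theory.
Import numFieldNormedType.Exports.

Local Open Scope classical_set_scope.
Local Open Scope ring_scope.

(* The product sigma-algebra on row vectors, generated by the coordinate maps,
   as for [n.-tuple T]. On ['rV[R]_n] this is the Borel sigma-algebra of R^n,
   since R is second countable. *)
Definition measure_rV_display : measure_display -> measure_display.
Proof. exact. Qed.

Section measurable_rV.
Context {d} {T : sigmaRingType d}.
Variable n : nat.

Let coors : 'I_n -> 'rV[T]_n -> T := fun i x => x ord0 i.

Let rV_set0 : g_sigma_preimage coors set0.
Proof. exact: sigma_algebra0. Qed.

Let rV_setC A : g_sigma_preimage coors A -> g_sigma_preimage coors (~` A).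
Proof. exact: sigma_algebraC. Qed.

Let rV_bigcup (F : (set 'rV[T]_n)^nat) :
  (forall i, g_sigma_preimage coors (F i)) ->
  g_sigma_preimage coors (\bigcup_i (F i)).
Proof. exact: sigma_algebra_bigcup. Qed.

HB.instance Definition _ := @isMeasurable.Build (measure_rV_display d)
  'rV[T]_n (g_sigma_preimage coors) rV_set0 rV_setC rV_bigcup.

End measurable_rV.

Lemma measurable_coord_rV d (T : sigmaRingType d) n (i : 'I_n) :
  measurable_fun [set: 'rV[T]_n] (fun x => x ord0 i).
Proof.
move=> _ Y mY; rewrite setTI; apply: sub_sigma_algebra => /=.
rewrite -bigcup_seq/=; exists i => /=; first by rewrite mem_index_enum.
by exists Y => //; rewrite setTI.
Qed.

Lemma measurable_fun_rVP d1 d2 (T1 : measurableType d1) (T2 : measurableType d2)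
    n (f : T1 -> 'rV[T2]_n) :
  (forall i, measurable_fun [set: T1] (fun x => f x ord0 i)) ->
  measurable_fun [set: T1] f.
Proof.
move=> mf; suff H : g_sigma_preimage (fun i x => f x ord0 i) `<=` measurable.
  move=> _ A mA; rewrite setTI; apply: H.
  rewrite -[X in g_sigma_preimage X]/(fun i => (fun v : 'rV[T2]_n => v ord0 i) \o f).
  rewrite g_sigma_preimage_comp; exists A => //; by rewrite setTI.
apply: smallest_sub; first exact: sigma_algebra_measurable.
case: n => [|n] in f mf *; first by rewrite big_ord0.
rewrite -bigcup_mkord_ord; apply: bigcup_sub => i Ii.
by move=> A [B mB <-]; exact: mf.
Qed.

Section cons_rV.
Context {R : realType}.

Definition cons_rV n (p : measurableTypeR R * 'rV[R]_n) :
    'rV[R]_n.+1 :=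
  row_mx (const_mx p.1 : 'rV_1) p.2.

Definition uncons_rV n (x : 'rV[R]_n.+1) :
    measurableTypeR R * 'rV[R]_n :=
  (x ord0 ord0, \row_i x ord0 (lift ord0 i)).

Lemma cons_rV0 n p : @cons_rV n p ord0 ord0 = p.1.
Proof.
rewrite /cons_rV (_ : ord0 = lshift n (ord0 : 'I_1)); last exact/val_inj.
by rewrite (row_mxEl (const_mx p.1 : 'rV_1)) mxE.
Qed.

Lemma cons_rVS n p i : @cons_rV n p ord0 (lift ord0 i) = p.2 ord0 i.
Proof.
rewrite /cons_rV (_ : lift ord0 i = rshift 1 i); last exact/val_inj.
by rewrite (row_mxEr (const_mx p.1 : 'rV_1)).
Qed.

Lemma cons_rVK n : cancel (@cons_rV n) (@uncons_rV n).
Proof.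
move=> p; rewrite /uncons_rV cons_rV0 [RHS]surjective_pairing; congr (_, _).
by apply/rowP => i; rewrite mxE cons_rVS.
Qed.

Lemma measurable_cons_rV n : measurable_fun setT (@cons_rV n).
Proof.
apply: measurable_fun_rVP => i; have [j ->|->] := unliftP ord0 i.
  under eq_fun do rewrite cons_rVS.
  exact: (measurableT_comp (measurable_coord_rV j) measurable_snd).
under eq_fun do rewrite cons_rV0.
exact: measurable_fst.
Qed.

Lemma measurable_uncons_rV n : measurable_fun setT (@uncons_rV n).
Proof.
apply: measurable_fun_pair; first exact: measurable_coord_rV.
apply: measurable_fun_rVP => i.
under eq_fun do rewrite mxE.
exact: measurable_coord_rV.
Qed.

End cons_rV.

Section lebesgue_measure_rV.
Context {R : realType}.
Local Open Scope ereal_scope.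

(* Lebesgue measure on R^n as an iterated product measure, transported along
   R * R^n -> R^(n+1); see [lebesgue_measure_rV_rect] for its value on boxes. *)
Fixpoint lebesgue_measure_rV n : set 'rV[R]_n -> \bar R :=
  if n is n'.+1 then
    pushforward (lebesgue_measure \x @lebesgue_measure_rV n') (@cons_rV R n')
  else \d_ (0%R : 'rV[R]_0).

End lebesgue_measure_rV.
Arguments lebesgue_measure_rV {R} n _.

Section lebesgue_measure_rV_is_measure.
Context {R : realType}.
Local Open Scope ereal_scope.

Section step.
Variables (n : nat) (m : {sigma_finite_measure set 'rV[R]_n -> \bar R}).

Let step : set 'rV[R]_n.+1 -> \bar R :=
  pushforward (lebesgue_measure \x m) (@cons_rV R n).

Let mcons (A : set 'rV[R]_n.+1) :
  measurable A -> measurable (@cons_rV R n @^-1` A).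
Proof. by move=> mA; rewrite -[X in measurable X]setTI; exact: measurable_cons_rV. Qed.

Let step0 : step set0 = 0.
Proof. by rewrite /step /pushforward preimage_set0 measure0. Qed.

Let step_ge0 A : 0 <= step A.
Proof. exact: (measure_ge0 (lebesgue_measure \x m)). Qed.

Let step_sigma_additive : semi_sigma_additive step.
Proof.
move=> F mF tF mUF; rewrite /step /pushforward preimage_bigcup.
apply: measure_semi_sigma_additive.
- by move=> k; exact: mcons.
- apply/trivIsetP => /= i j _ _ ij; rewrite -preimage_setI.
  by move/trivIsetP : tF => /(_ _ _ _ _ ij) ->//; rewrite preimage_set0.
- by rewrite -preimage_bigcup; exact: mcons.
Qed.

Let step_sigma_finite : sigma_finite setT step.
Proof.
have /sigma_finiteP[F [TF ndF Foo]] := sigma_finiteT (@lebesgue_measure R).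
have /sigma_finiteP[G [TG ndG Goo]] := sigma_finiteT m.
exists (fun k => @uncons_rV R n @^-1` (F k `*` G k)).
  rewrite -preimage_bigcup -[LHS](preimage_setT (@uncons_rV R n)).
  congr (_ @^-1` _); rewrite -setXTT TF TG predeqE => -[x y]; split.
    move=> [/= [i _ Fix] [j _ Gjy]]; exists (maxn i j) => //; split.
    - by move: x Fix; exact/subsetPset/ndF/leq_maxl.
    - by move: y Gjy; exact/subsetPset/ndG/leq_maxr.
  by move=> [k _ []/= ? ?]; split; exists k.
move=> k; have [? ?] := Foo k; have [? ?] := Goo k; split.
  rewrite -[X in measurable X]setTI.
  by apply: measurable_uncons_rV => //; exact: measurableX.
rewrite /step /pushforward -comp_preimage.
rewrite (_ : _ \o _ = id); last by apply/funext => p /=; rewrite cons_rVK.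
by rewrite preimage_id product_measure1E// lte_mul_pinfty// ge0_fin_numE.
Qed.

HB.instance Definition _ := isMeasure.Build _ _ _ step
  step0 step_ge0 step_sigma_additive.

HB.instance Definition _ := Measure_isSigmaFinite.Build _ _ _ step
  step_sigma_finite.

Lemma lebesgue_measure_rV_step :
  exists m' : {sigma_finite_measure set 'rV[R]_n.+1 -> \bar R},
    pushforward (lebesgue_measure \x m) (@cons_rV R n) = m' :> (_ -> _).
Proof. by exists step. Qed.

End step.

Lemma lebesgue_measure_rV_ex n :
  exists m : {sigma_finite_measure set 'rV[R]_n -> \bar R},
    @lebesgue_measure_rV R n = m :> (_ -> _).
Proof.
elim: n => [|n [m mE]] /=; last by rewrite mE; exact: lebesgue_measure_rV_step.
by exists \d_(0%R : 'rV[R]_0).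
Qed.

Section instance.
Variable n : nat.

Let leb0 : @lebesgue_measure_rV R n set0 = 0.
Proof. by have [m ->] := lebesgue_measure_rV_ex n; exact: measure0. Qed.

Let leb_ge0 A : 0 <= @lebesgue_measure_rV R n A.
Proof. by have [m ->] := lebesgue_measure_rV_ex n; exact: measure_ge0. Qed.

Let leb_sigma_additive : semi_sigma_additive (@lebesgue_measure_rV R n).
Proof.
by have [m ->] := lebesgue_measure_rV_ex n; exact: measure_semi_sigma_additive.
Qed.

Let leb_sigma_finite : sigma_finite setT (@lebesgue_measure_rV R n).
Proof. by have [m ->] := lebesgue_measure_rV_ex n; exact: sigma_finiteT. Qed.

HB.instance Definition _ := isMeasure.Build _ _ _ (@lebesgue_measure_rV R n)
  leb0 leb_ge0 leb_sigma_additive.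

HB.instance Definition _ := Measure_isSigmaFinite.Build _ _ _
  (@lebesgue_measure_rV R n) leb_sigma_finite.

End instance.

Lemma lebesgue_measure_rV_rect n (A : 'I_n -> set R) :
  (forall i, measurable (A i)) ->
  lebesgue_measure_rV n [set x | forall i, A i (x ord0 i)] =
  \prod_(i < n) lebesgue_measure (A i).
Proof.
elim: n A => [|n IHn] A mA.
  by rewrite big_ord0 /= diracE mem_set//= => -[].
have mB : measurable [set x : 'rV[R]_n | forall i, A (lift ord0 i) (x ord0 i)].
  rewrite (_ : mkset _ = \bigcap_(i in [set: 'I_n])
      ((fun x : 'rV[R]_n => x ord0 i) @^-1` A (lift ord0 i))).
    apply: fin_bigcap_measurable => // i _; rewrite -[X in measurable X]setTI.
    exact: measurable_coord_rV.
  by apply/seteqP; split => [x Ax i _|x Ax i]; exact: Ax.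
rewrite big_ord_recl /= -IHn// /pushforward -product_measure1E//;
  last exact: (mA ord0).
congr (product_measure1 _ _ _); apply/seteqP; split => -[a x] /=.
  move=> Aax; split; first by have := Aax ord0; rewrite cons_rV0.
  by move=> i; have := Aax (lift ord0 i); rewrite cons_rVS.
move=> [/= Aa Ax] i; have [j ->|->] := unliftP ord0 i.
  by rewrite cons_rVS; exact: Ax.
by rewrite cons_rV0.
Qed.

End lebesgue_measure_rV_is_measure.

Section convex_bodies.
Context {R : realType} {n : nat}.
Implicit Types K S : set 'rV[R]_n.

(* [fine] maps +oo to 0; this is harmless on compact sets, whose measure is
   finite. *)
Definition vol K : R := fine (lebesgue_measure_rV n K).

Definition convex_body K := [/\ compact K, convex_set K & K^° !=set0].

(* The volume centroid, computed coordinatewise. *)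
Definition barycenter K : 'rV[R]_n :=
  (vol K)^-1 *: \row_(i < n) \int[lebesgue_measure_rV n]_(x in K) x ord0 i.

Definition affinely_independent m (p : 'I_m -> 'rV[R]_n) :=
  forall a : 'I_m -> R, \sum_(i < m) a i = 0 ->
    \sum_(i < m) a i *: p i = 0 -> forall i, a i = 0.

Definition convex_hull (A : set 'rV[R]_n) : set 'rV[R]_n :=
  smallest (@convex_set R 'rV[R]_n) A.

Definition simplex S := exists2 p : 'I_n.+1 -> 'rV[R]_n,
  affinely_independent p & S = convex_hull (range p).

End convex_bodies.

(* Main.v *)
Require Import Defs.
From mathcomp Require Import all_boot all_order all_algebra.
From mathcomp Require Import all_classical all_reals all_analysis measurable_realfun.
From mathcomp Require Import ring lra zify.

(* Let L = K ∩ (-K). Since K has barycenter 0, vol L >= 2^(-6n) vol K: every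
   halfspace whose bounding hyperplane passes near 0 carries a 2^(-n-1) fraction
   of K (Markov plus a homothety at an extreme point), hence by Tonelli contains
   a point x with vol (K ∩ (x - K)) large; the set of such x is convex by
   Brunn-Minkowski, so it approaches 0 arbitrarily closely.
   Let M be the matrix of second moments of the uniform measure on L. A Gaussian
   integral gives vol L <= C^n sqrt (det M), and choosing greedily points of L
   that are large for the current quadratic form gives y_1, ..., y_n in L with
   det (y_1, ..., y_n)^2 >= n! det M. With y_0 = 0 the cyclic differences
   v_i = (y_i - y_(i-1)) / 2 lie in L and sum to 0; they span a simplex of volume
   at least 2^(-n) |det y| n^(-n) with barycenter 0. *)

Set Implicit Arguments.
Unset Strict Implicit.
Unset Printing Implicit Defensive.

Import Order.TTheory GRing.Theory Num.Theory.
Import numFieldNormedType.Exports.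

Local Open Scope classical_set_scope.
Local Open Scope ring_scope.

(** * Borel sets and boundedness *)

Section measurable_sets_rV.
Context {R : realType}.

(** An [n]-th root is taken at the end, so each stage may lose a factor [C ^ n]; this is why bounds
    as crude as [2 ^- (6 * n)] suffice. A symmetric subset is what allows recentering: points of [K]
    with a large determinant have no reason to average to 0, whereas half the difference of two
    points of a symmetric convex set stays in it. The differences are cyclic because they then sum
    to 0, while the first [n] of them arise from the [y_i] by a unitriangular matrix, so that
    halving is the only loss in the determinant. The rate [1 / sqrt n] is the balance of what
    remains: the greedy choice gains [sqrt (n!)], about [n ^ (n/2)] up to [C ^ n], over
    [sqrt (det M)], while the volume of the simplex is only about [n ^ (-n)] times its determinant.
    The Gaussian comparison behaves well under all linear maps, so [L] is used as it stands, without
    being moved to isotropic position. *)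

Lemma measurable_forall_rV n (A : 'I_n -> set R) :
  (forall i, measurable (A i)) ->
  measurable [set x : 'rV[R]_n | forall i, A i (x ord0 i)].
Proof.
move=> mA; rewrite (_ : mkset _ = \bigcap_(i in [set: 'I_n])
    ((fun x : 'rV[R]_n => x ord0 i) @^-1` A i)).
  apply: fin_bigcap_measurable => // i _; rewrite -[X in measurable X]setTI.
  exact: measurable_coord_rV.
by apply/seteqP; split => [x Ax i _|x Ax i]; exact: Ax.
Qed.

(** The sigma-algebra is generated by the coordinates, so an open set has to be exhibited as a
    countable union of boxes: those with rational center and radius [1/(k+1)] that it contains. *)
Lemma open_measurable_rV n (U : set 'rV[R]_n) : open U -> measurable U.
Proof.
move=> oU.
pose box (p : 'rV[rat]_n * nat) : set 'rV[R]_n :=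
  [set x | forall i, ball (ratr (p.1 ord0 i) : R) p.2.+1%:R^-1 (x ord0 i)].
pose F p := if `[< box p `<=` U >] then box p else set0.
rewrite (_ : U = \bigcup_p F p).
  apply: countable_bigcupT_measurable => // p; rewrite /F; case: ifP => // _.
  apply: (measurable_forall_rV (A := fun i => ball (ratr (p.1 ord0 i) : R) p.2.+1%:R^-1)).
  by move=> i; exact: measurable_ball.
apply/seteqP; split => [x Ux|x [p _]]; last by rewrite /F; case: asboolP => // + bx; exact.
have /nbhs_ballP[e /= e0 xeU] : nbhs x U by exact: open_nbhs_nbhs.
(* A radius below [e / 2]: both [x] and every point of the box are that close to the rational
   center, so the box stays in the [e]-ball around [x]. *)
pose k := Num.truncn (e / 2)^-1.
pose r : R := k.+1%:R^-1.
have re : r < e / 2.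
  rewrite invf_plt ?posrE ?divr_gt0//.
  rewrite -truncn_lt_nat ?invr_ge0 ?divr_ge0 ?ltW//.
have r0 : 0 < r by rewrite invr_gt0.
have /choice[q xq] i : exists q : rat, ball (ratr q : R) r (x ord0 i).
  have [|q] := @rat_in_itvoo R (x ord0 i - r) (x ord0 i + r); first by lra.
  rewrite in_itv/= => /andP[q1 q2]; exists q.
  by rewrite /ball/= ltr_norml; apply/andP; split; lra.
exists (\row_i q i, k) => //; rewrite /F; case: asboolP.
  by move=> _ i /=; rewrite mxE; exact: xq.
case=> y /= yq; apply: xeU; split => // i j; rewrite (ord1 i).
have := xq j; have := yq j; rewrite /= mxE /ball/= -/r !ltr_norml.
by move=> /andP[? ?] /andP[? ?]; apply/andP; split; lra.
Qed.

Lemma closed_measurable_rV n (A : set 'rV[R]_n) : closed A -> measurable A.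
Proof.
by move=> cA; rewrite -(setCK A); apply: measurableC; apply: open_measurable_rV; exact: closed_openC.
Qed.

Lemma compact_closed_rV n (A : set 'rV[R]_n) : compact A -> closed A.
Proof. by apply: compact_closed; exact: norm_hausdorff. Qed.

Lemma compact_measurable_rV n (A : set 'rV[R]_n) : compact A -> measurable A.
Proof. by move=> /compact_closed_rV/closed_measurable_rV. Qed.

Lemma compact_coord_bounded n (A : set 'rV[R]_n) : compact A ->
  exists2 B : R, 0 < B & forall x, A x -> forall i, `|x ord0 i| <= B.
Proof.
move=> /compact_bounded[M [_ MA]].
exists (`|M| + 1) => [|x Ax i]; first by rewrite ltr_wpDl.
apply: le_trans (MA (`|M| + 1) _ x Ax); last by rewrite (le_lt_trans (ler_norm M))// ltrDl.
rewrite [leRHS]/Num.norm /= mx_normrE; apply/bigmax_geP; right; exists (ord0, i) => //=; rewrite mem_enum.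
Qed.

Lemma lebesgue_measure_rV_bounded n (A : set 'rV[R]_n) (B : R) : measurable A ->
  (forall x, A x -> forall i, `|x ord0 i| <= B) ->
  (lebesgue_measure_rV n A < +oo)%E.
Proof.
move=> mA AB.
have mB : measurable [set x : 'rV[R]_n | forall i, `[(- B), B]%classic (x ord0 i)].
  exact: (measurable_forall_rV (A := fun=> `[(- B), B]%classic)).
apply: (@le_lt_trans _ _ (lebesgue_measure_rV n [set x | forall i, `[(- B), B]%classic (x ord0 i)])).
  by apply: le_measure; rewrite ?inE// => x /AB Ax i /=; rewrite in_itv/= -ler_norml; exact: Ax.
rewrite (@lebesgue_measure_rV_rect _ _ (fun=> `[(- B), B]%classic))//.
suff : (\prod_(i < n) lebesgue_measure `[(- B)%R, B]%classic \is a fin_num)%E.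
  by rewrite ge0_fin_numE//; apply: prode_ge0.
elim/big_ind : _ => // [x y|i _]; first exact: fin_numM.
by rewrite lebesgue_measure_itv/=; case: ifP.
Qed.

Lemma compact_measure_lty n (A : set 'rV[R]_n) : compact A -> (lebesgue_measure_rV n A < +oo)%E.
Proof.
move=> cA; have [B _ AB] := compact_coord_bounded cA.
by apply: (lebesgue_measure_rV_bounded _ AB); exact: compact_measurable_rV.
Qed.

End measurable_sets_rV.

(** * Maps scaling a measure *)

Section scaling_maps.
Local Open Scope ereal_scope.
Context d (X : measurableType d) (R : realType).
Implicit Type m : {measure set X -> \bar R}.

(** Preimages rather than images, so that composition is immediate. The factor of an invertible
    linear map is accordingly the inverse of its absolute determinant. *)
Definition scales m (T : X -> X) (c : R) :=
  [/\ measurable_fun setT T, (0 <= c)%R &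
      forall A, measurable A -> m (T @^-1` A) = c%:E * m A].

Lemma scales_comp m T U c e : scales m T c -> scales m U e ->
  scales m (U \o T) (c * e).
Proof.
move=> [mT c0 Tc] [mU e0 Ue]; split; [exact: measurableT_comp|exact: mulr_ge0|].
move=> A mA; rewrite comp_preimage Tc ?Ue ?EFinM ?muleA//.
by rewrite -[X in measurable X]setTI; exact: mU.
Qed.

Lemma ge0_integral_scales m T c (f : X -> \bar R) : scales m T c ->
  measurable_fun setT f -> (forall x, 0 <= f x) ->
  \int[m]_x f (T x) = c%:E * \int[m]_x f x.
Proof.
move=> [mT c0 Tc] mf f0.
pose m' : measure X R := measure_function_pushforward__canonical__measure_function_Measure m mT.
rewrite -[LHS](ge0_integral_pushforward mT m (D := setT))//.
rewrite -(ge0_integral_mscale m measurableT (NngNum c0))//.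
by apply: (@eq_measure_integral _ _ _ _ (mscale (NngNum c0) m) m') => A mA _; exact: Tc.
Qed.

End scaling_maps.

(** * Linear changes of variables for Lebesgue measure *)

Section linear_maps.
Local Open Scope ereal_scope.
Context {R : realType}.
Notation mu n := (@lebesgue_measure_rV R n).
Notation leb := (@lebesgue_measure R).

(** Lebesgue measure is determined by its values on half-open intervals, so [|a|] times the
    pushforward is tested on these; a negative slope moves the closed end to the other side. *)
Lemma scales_affine (a b : R) : (a != 0)%R ->
  scales leb (fun x : measurableTypeR R => (x * a + b)%R : measurableTypeR R) (`|a|^-1)%R.
Proof.
move=> a0; set T := (X in scales _ X _).
have mT : measurable_fun setT T by apply: measurable_funD => //; exact: measurable_funM.
split => // A mA.
have na0 : (0 <= `|a|)%R by [].
pose pT : measure (measurableTypeR R) R :=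
  measure_function_pushforward__canonical__measure_function_Measure leb mT.
pose m' := mscale (NngNum na0) pT.
suff mE : leb A = m' A.
  by rewrite [X in _ = _ * X]mE /m' /mscale/= muleA -EFinM mulVf ?normr_eq0// mul1e.
apply: lebesgue_measure_unique => // _ [[c e]] _ <-.
rewrite [RHS](_ : _ = `|a|%:E * leb (T @^-1` `]c, e]%classic))//.
have [a_gt0|a_le0] := ltP 0%R a.
  rewrite (_ : T @^-1` _ = `]((c - b) / a)%R, ((e - b) / a)%R]%classic); last first.
    apply/seteqP; split => x /=; rewrite !in_itv/= /T ltr_pdivrMr// ler_pdivlMr//.
      by move=> /andP[? ?]; apply/andP; split; lra.
    by move=> /andP[? ?]; apply/andP; split; lra.
  rewrite !lebesgue_measure_itv/= !lte_fin ltr_pM2r ?invr_gt0// ltrD2r.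
  case: ifP => _; rewrite ?mule0// -EFinD -EFinM gtr0_norm//; congr (_%:E).
  by field.
have a_lt0 : (a < 0)%R by rewrite lt_neqAle a0.
rewrite (_ : T @^-1` _ = `[((e - b) / a)%R, ((c - b) / a)%R[%classic); last first.
  apply/seteqP; split => x /=; rewrite !in_itv/= /T ltr_ndivlMr// ler_ndivrMr//.
    by move=> /andP[? ?]; apply/andP; split; lra.
  by move=> /andP[? ?]; apply/andP; split; lra.
rewrite !lebesgue_measure_itv/= !lte_fin ltr_nM2r ?invr_lt0// ltrD2r.
case: ifP => _; rewrite ?mule0// -EFinD -EFinM ltr0_norm//; congr (_%:E).
by field.
Qed.

Lemma measurable_cons_pre n (A : set 'rV[R]_n.+1) : measurable A ->
  measurable (@cons_rV R n @^-1` A).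
Proof. by move=> mA; rewrite -[X in measurable X]setTI; exact: measurable_cons_rV. Qed.

Lemma measurable_section n (A : set 'rV[R]_n.+1) s : measurable A ->
  measurable [set y | A (cons_rV (s, y))].
Proof.
move=> /measurable_cons_pre/(measurable_xsection s).
by rewrite (_ : xsection _ _ = [set y | A (cons_rV (s, y))])//; apply/seteqP; split => y /=; rewrite xsectionE.
Qed.

Lemma measurable_section2 n (A : set 'rV[R]_n.+1) y : measurable A ->
  measurable [set s : measurableTypeR R | A (cons_rV (s, y))].
Proof.
move=> /measurable_cons_pre/(measurable_ysection y).
by rewrite (_ : ysection _ _ = [set s | A (cons_rV (s, y))])//; apply/seteqP; split => s /=; rewrite ysectionE.
Qed.

Lemma measurable_measure_section n (A : set 'rV[R]_n.+1) : measurable A ->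
  measurable_fun setT (fun s : measurableTypeR R => mu n [set y | A (cons_rV (s, y))]).
Proof.
move=> /measurable_cons_pre/(measurable_fun_xsection (mu n)).
by apply: eq_measurable_fun => s _ /=; congr (mu n _); rewrite xsectionE.
Qed.

Lemma measurable_measure_section2 n (A : set 'rV[R]_n.+1) : measurable A ->
  measurable_fun setT (fun y => leb [set s | A (cons_rV (s, y))]).
Proof.
move=> /measurable_cons_pre/(measurable_fun_ysection leb).
by apply: eq_measurable_fun => y _ /=; congr (leb _); rewrite ysectionE.
Qed.

Lemma lebesgue_measure_rVS n (A : set 'rV[R]_n.+1) :
  mu n.+1 A = \int[leb]_s mu n [set y | A (cons_rV (s, y))].
Proof.
rewrite /= /pushforward /product_measure1; apply: eq_integral => s _ /=.
by congr (mu n _); rewrite xsectionE.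
Qed.

(** The product measure is unique, so the first coordinate may also be integrated innermost; this
    order serves the maps that shear the first coordinate along the others. *)
Lemma lebesgue_measure_rVS2 n (A : set 'rV[R]_n.+1) : measurable A ->
  mu n.+1 A = \int[mu n]_y leb [set s | A (cons_rV (s, y))].
Proof.
move=> /measurable_cons_pre mA; rewrite /= /pushforward.
rewrite (product_measure_unique (m' := leb \x^ mu n))//; last exact: product_measure2E.
rewrite /product_measure2; apply: eq_integral => s _ /=.
by congr (leb _); rewrite ysectionE.
Qed.

(** Tonelli for triangular maps: the new first coordinate depends on the old one alone, and all
    slices are mapped with the same factor [e]. *)
Lemma scales_cons1 n (T : 'rV[R]_n.+1 -> 'rV[R]_n.+1) f h c e :
  measurable_fun setT T -> (forall s y, T (cons_rV (s, y)) = cons_rV (f s, h s y)) ->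
  scales leb f c -> (forall s, scales (mu n) (h s) e) -> scales (mu n.+1) T (c * e).
Proof.
move=> mT TE fc he; have [_ c0 _] := fc; have [_ e0 _] := he 0%R.
split => //; first exact: mulr_ge0.
move=> A mA; rewrite [LHS]lebesgue_measure_rVS.
transitivity (\int[leb]_s (e%:E * mu n [set y | A (cons_rV (f s, y))])).
  apply: eq_integral => s _; have [_ _ <-] := he s; last exact: measurable_section.
  by congr (mu n _); apply/seteqP; split => y /=; rewrite TE.
rewrite ge0_integralZl//; last first.
  have [mf _ _] := fc.
  exact: (measurableT_comp (measurable_measure_section mA) mf).
rewrite (ge0_integral_scales (f := fun s => mu n [set y | A (cons_rV (s, y))]) fc)//.
  by rewrite [X in _ = _ * X]lebesgue_measure_rVS muleA -EFinM mulrC.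
exact: measurable_measure_section.
Qed.

Lemma scales_cons2 n (T : 'rV[R]_n.+1 -> 'rV[R]_n.+1) f h c e :
  measurable_fun setT T -> (forall s y, T (cons_rV (s, y)) = cons_rV (h y s, f y)) ->
  scales (mu n) f c -> (forall y, scales leb (h y) e) -> scales (mu n.+1) T (c * e).
Proof.
move=> mT TE fc he; have [_ c0 _] := fc; have [_ e0 _] := he 0%R.
split => //; first exact: mulr_ge0.
have [mf _ _] := fc.
move=> A mA; rewrite [LHS]lebesgue_measure_rVS2; last first.
  by rewrite -[X in measurable X]setTI; exact: mT.
transitivity (\int[mu n]_y (e%:E * leb [set s | A (cons_rV (s, f y))])).
  apply: eq_integral => y _; have [_ _ <-] := he y; last exact: measurable_section2.
  by congr (leb _); apply/seteqP; split => s /=; rewrite TE.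
rewrite ge0_integralZl//; last first.
  exact: (measurableT_comp (measurable_measure_section2 mA) mf).
rewrite (ge0_integral_scales (f := fun y => leb [set s | A (cons_rV (s, y))]) fc)//.
  by rewrite [X in _ = _ * X]lebesgue_measure_rVS2// muleA -EFinM mulrC.
exact: measurable_measure_section2.
Qed.

Lemma continuous_measurable_rV n (f : 'rV[R]_n -> R) :
  continuous f -> measurable_fun setT f.
Proof.
move=> /continuousP cf; apply: (measurability _ (RGenOpens.measurableE R)).
move=> _ [_ [a [b ->] <-]]; rewrite setTI; apply: open_measurable_rV.
exact/cf/interval_open.
Qed.

Lemma measurable_mulmx n k (P : 'M[R]_(n, k)) :
  measurable_fun setT (fun x : 'rV[R]_n => x *m P).
Proof.
apply: measurable_fun_rVP => i; under eq_fun do rewrite mxE.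
apply: measurable_sum => j; apply: measurable_funM => //.
exact: measurable_coord_rV.
Qed.

Lemma measurable_addrV n (v : 'rV[R]_n) : measurable_fun setT (fun x : 'rV[R]_n => (x + v)%R).
Proof.
apply: measurable_fun_rVP => i; under eq_fun do rewrite mxE.
by apply: measurable_funD => //; exact: measurable_coord_rV.
Qed.

Lemma cons_rV_uncons n (x : 'rV[R]_n.+1) : cons_rV (uncons_rV x) = x.
Proof.
apply/rowP => i; have [j ->|->] := unliftP ord0 i; last by rewrite cons_rV0.
by rewrite cons_rVS mxE.
Qed.

Lemma cons_rVD n (s t : R) (x y : 'rV[R]_n) :
  cons_rV (s + t, x + y)%R = (cons_rV (s, x) + cons_rV (t, y))%R :> 'rV[R]_n.+1.
Proof.
apply/rowP => i; have [j ->|->] := unliftP ord0 i; rewrite [RHS]mxE; last by rewrite !cons_rV0.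
by rewrite !cons_rVS/= mxE.
Qed.

Lemma cons_rVZ n (s t : R) (x : 'rV[R]_n) :
  cons_rV (s * t, s *: x)%R = (s *: cons_rV (t, x))%R :> 'rV[R]_n.+1.
Proof.
apply/rowP => i; have [j ->|->] := unliftP ord0 i; rewrite [RHS]mxE; last by rewrite !cons_rV0.
by rewrite !cons_rVS/= mxE.
Qed.

Lemma scales_translate n (v : 'rV[R]_n) : scales (mu n) (fun x => x + v)%R 1.
Proof.
elim: n v => [|n IHn] v.
  have -> : (fun x : 'rV[R]_0 => x + v)%R = id by apply/funext => x; rewrite (thinmx0 v) addr0.
  by split => // A mA; rewrite mul1e.
have v0 : scales leb (fun x => x + v ord0 ord0)%R 1.
  have := scales_affine (v ord0 ord0) (oner_neq0 R).
  by rewrite normr1 invr1 (_ : (fun x => x * 1 + _)%R = (fun x => x + v ord0 ord0)%R)//; apply/funext => x; rewrite mulr1.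
rewrite -[1%R]mulr1.
apply: (scales_cons1 (h := fun _ y => (y + (uncons_rV v).2)%R) (measurable_addrV v) _ v0) => // s y.
by rewrite -[v in LHS]cons_rV_uncons -cons_rVD.
Qed.

Lemma block_mx_lift n (A : 'M[R]_1) (b : 'rV[R]_n) (c : 'cV[R]_n) (D : 'M[R]_n) (i : 'I_n) :
  (block_mx A b c D : 'M[R]_n.+1) ord0 (lift ord0 i) = b ord0 i.
Proof.
rewrite -(@block_mxEur R 1 n 1 n A b c D ord0 i).
by congr (fun_of_matrix _ _ _); exact/val_inj.
Qed.

Lemma cons_rV_block n (a s : R) (b : 'rV[R]_n) (c : 'cV[R]_n) (S : 'M[R]_n) y :
  cons_rV (s, y) *m (block_mx a%:M b c S : 'M[R]_n.+1) =
  cons_rV (s * a + (y *m c) ord0 ord0, s *: b + y *m S)%R.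
Proof.
have H := @mul_row_block R 1 1 n 1 n (const_mx s) y a%:M b c S.
rewrite /cons_rV /=; refine (etrans H _); congr row_mx.
  by apply/rowP => i; rewrite (ord1 i) !mxE big_ord1 !mxE eqxx mulr1n.
congr (_ + _)%R; apply/rowP => i.
by rewrite !mxE big_ord1 !mxE.
Qed.

(** On the slice with first coordinate [s] the map is [S] followed by the translation by
    [s *: b]. *)
Lemma scales_ublock n (a : R) (b : 'rV[R]_n) (S : 'M[R]_n) (c : R) : (a != 0)%R ->
  scales (mu n) (fun x => x *m S) c ->
  scales (mu n.+1) (fun x => x *m (block_mx a%:M b 0 S : 'M[R]_n.+1)) (`|a|^-1 * c).
Proof.
move=> a0 Sc.
apply: (@scales_cons1 n _ _ (fun s y => s *: b + y *m S)%R _ _ _ _ (scales_affine 0 a0)).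
  exact: measurable_mulmx.
  by move=> s y; rewrite cons_rV_block mulmx0 mxE.
move=> s; rewrite -[c]mulr1.
have := scales_comp Sc (scales_translate (s *: b)).
by congr (scales _ _ _); apply/funext => x /=; rewrite addrC.
Qed.

Lemma scales_lblock n (c : 'cV[R]_n) :
  scales (mu n.+1) (fun x => x *m (block_mx 1%:M 0 c 1%:M : 'M[R]_n.+1)) 1.
Proof.
suff : scales (mu n.+1) (fun x => x *m (block_mx 1%:M 0 c 1%:M : 'M[R]_n.+1)) (1 * 1) by rewrite mulr1.
have id1 : scales (mu n) id 1 by split => // A mA; rewrite mul1e.
apply: (@scales_cons2 n _ _ (fun y s => s * 1 + (y *m c) ord0 ord0)%R _ _ _ _ id1).
  exact: measurable_mulmx.
  by move=> s y; rewrite cons_rV_block mulmx1 scaler0 add0r.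
by move=> y; have := scales_affine ((y *m c) ord0 ord0) (oner_neq0 R); rewrite normr1 invr1.
Qed.

(* Induction on n: a shear makes the corner entry nonzero, then a block LU
   factorization reduces the map to one-dimensional ones by Tonelli. *)
Lemma scales_mulmx n (P : 'M[R]_n) : P \in unitmx ->
  scales (mu n) (fun x => x *m P) `|\det P|^-1.
Proof.
elim: n P => [|n IHn] P uP.
  rewrite det_mx00 normr1 invr1 (_ : (fun x => x *m P) = id); last first.
    by apply/funext => x; rewrite [LHS]thinmx0 [RHS]thinmx0.
  by split => // A mA; rewrite mul1e.
have [e Pe] : exists e : 'rV[R]_n, ((block_mx 1%:M e 0 1%:M : 'M[R]_n.+1) *m P) ord0 ord0 != 0%R.
  have [P0|P0] := eqVneq (P ord0 ord0) 0%R; last first.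
    by exists 0%R; rewrite -(@scalar_mx_block _ 1 n 1) mul1mx.
  have [i Pi] : exists i : 'I_n, P (lift ord0 i) ord0 != 0%R.
    apply: contrapT => nP.
    have P00 i : P i ord0 = 0%R.
      have [j ->|->//] := unliftP ord0 i.
      by apply: contrapT => /eqP h; apply: nP; exists j.
    move: uP; rewrite unitmxE unitfE (expand_det_col _ ord0) big1 ?eqxx// => j _.
    by rewrite P00 mul0r.
  exists (delta_mx ord0 i).
  rewrite mxE big_ord_recl P0 mulr0 add0r (bigD1 i)//= big1 => [|j ji].
    by rewrite addr0 block_mx_lift mxE !eqxx mul1r.
  by rewrite block_mx_lift mxE (negbTE ji) andbF mul0r.
pose E : 'M[R]_n.+1 := block_mx 1%:M e 0 1%:M.
pose E' : 'M[R]_n.+1 := block_mx 1%:M (- e)%R 0 1%:M.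
have E'E : E' *m E = 1%:M.
  rewrite /E /E' [LHS](@mulmx_block _ 1 n 1 n 1 n) !mul1mx !mulmx1 !mul0mx !mulmx0 !addr0 add0r subrr.
  by rewrite -scalar_mx_block.
pose Q : 'M[R]_(1 + n) := E *m P.
pose p := Q ord0 ord0.
(* Schur complement of the pivot [p]; it is invertible because [\det Q = p * \det S]. *)
pose S := (drsubmx Q - dlsubmx Q *m (p^-1 *: ursubmx Q))%R.
have QE : Q = (block_mx 1%:M 0 (p^-1 *: dlsubmx Q) 1%:M : 'M[R]_(1 + n)) *m block_mx p%:M (ursubmx Q) 0 S.
  rewrite [RHS](@mulmx_block _ 1 n 1 n 1 n) !mul1mx !mul0mx !addr0 -[LHS]submxK.
  congr block_mx.
  - rewrite [LHS]mx11_scalar /p; move: (Q) => Q0; congr _%:M; rewrite !mxE.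
    by congr (fun_of_matrix Q0 _ _); exact/val_inj.
  - by rewrite mul_mx_scalar scalerA mulfV// scale1r.
  - by rewrite /S -scalemxAl -scalemxAr addrC subrK.
have detQ : \det Q = \det P.
  by rewrite /Q det_mulmx (@det_ublock _ 1 n) !det1 !mul1r.
have detS : \det Q = (p * \det S)%R.
  by rewrite QE det_mulmx (@det_lblock _ 1 n) (@det_ublock _ 1 n) !det1 !mul1r det_scalar1.
have uS : S \in unitmx.
  rewrite unitmxE unitfE; apply: contraTneq uP => S0.
  by rewrite unitmxE unitfE -detQ detS S0 mulr0 eqxx.
have s1 := scales_ublock (- e)%R (oner_neq0 R) (IHn 1%:M (unitmx1 _ _)).
have s2 := scales_lblock (p^-1 *: dlsubmx Q).
have s3 := scales_ublock (ursubmx Q) Pe (IHn _ uS).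
have := scales_comp (scales_comp s1 s2) s3.
rewrite det1 !normr1 !invr1 !mul1r -[\det P]detQ detS normrM invfM.
congr (scales _ _ _); apply/funext => x /=.
rewrite -/E' -!mulmxA; congr (_ *m _).
by rewrite -[X in _ *m X]QE /Q mulmxA E'E mul1mx.
Qed.
End linear_maps.

(** * The Brunn-Minkowski inequality *)

Section prekopa.
Local Open Scope ereal_scope.
Context {R : realType}.
Notation leb := (@lebesgue_measure R).

Definition cvx (V : lmodType R) (A : set V) :=
  forall x y (t : R), (0 <= t)%R -> (t <= 1)%R -> A x -> A y -> A (t *: x + (1 - t) *: y)%R.

(** The endpoints need not belong to [I], but a point strictly between them lies between two members
    of [I]. It is given by its weight [u] so that one [u] can pick points of two intervals at
    once. *)
Lemma interval_inf_sup (I : set R) (u : R) : cvx (I : set R^o) -> I !=set0 -> has_ubound I ->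
  has_lbound I -> (0 < u < 1)%R -> I ((1 - u) * inf I + u * sup I)%R.
Proof.
move=> cI [x Ix] uI lI /andP[u0 u1].
have infx : (inf I <= x)%R by exact: ge_inf.
have supx : (x <= sup I)%R by exact: ub_le_sup.
have [E|E] := eqVneq (inf I) (sup I).
  have -> // : ((1 - u) * inf I + u * sup I = x)%R.
  have : (x = sup I)%R by apply/eqP; rewrite eq_le supx -E infx.
  by rewrite E => <-; ring.
have infsup : (inf I < sup I)%R by rewrite lt_neqAle E (le_trans infx).
set s := (X in I X).
have [y Iy ys] : exists2 y, I y & (y < s)%R.
  apply: inf_lt; first by exists x.
  by rewrite /s; nra.
have [z Iz sz] : exists2 z, I z & (s < z)%R.
  apply: sup_gt; first by exists x.
  by rewrite /s; nra.
have yz : (0 < z - y)%R by lra.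
have := cI z y ((s - y) / (z - y))%R _ _ Iz Iy.
have -> : (((s - y) / (z - y)) *: (z : R^o) + (1 - (s - y) / (z - y)) *: (y : R^o) = s)%R.
  by rewrite /GRing.scale/=; field; rewrite lt0r_neq0.
apply; first by apply: divr_ge0; lra.
rewrite ler_pdivrMr// mul1r; lra.
Qed.

Lemma leb_itv_bnd x y (a b : R) : (a <= b)%R ->
  leb [set` Interval (BSide x a) (BSide y b)] = (b - a)%:E.
Proof.
rewrite lebesgue_measure_itv/= lte_fin le_eqVlt => /predU1P[->|->].
  by rewrite ltxx subrr.
by rewrite EFinB.
Qed.

(** [C] contains the open interval from the combination of the infima to that of the suprema: its
    point of weight [u] combines the points of the same weight in [I] and [J]. *)
Lemma brunn_minkowski1 (I J C : set (measurableTypeR R)) (t : R) : (0 < t < 1)%R ->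
  cvx (I : set R^o) -> cvx (J : set R^o) -> I !=set0 -> J !=set0 ->
  has_ubound (I : set R) -> has_lbound (I : set R) ->
  has_ubound (J : set R) -> has_lbound (J : set R) ->
  measurable I -> measurable J -> measurable C ->
  (forall x y, I x -> J y -> C (t * x + (1 - t) * y)%R) ->
  t%:E * leb I + (1 - t)%:E * leb J <= leb C.
Proof.
move=> /andP[t0 t1] cI cJ I0 J0 uI lI uJ lJ mI mJ mC IJC.
pose i0 : R := inf (I : set R); pose i1 : R := sup (I : set R).
pose j0 : R := inf (J : set R); pose j1 : R := sup (J : set R).
have lenle (K : set (measurableTypeR R)) : K !=set0 -> has_ubound (K : set R) ->
    has_lbound (K : set R) -> measurable K -> (inf (K : set R) <= sup (K : set R))%R /\
    leb K <= (sup (K : set R) - inf (K : set R))%:E.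
  move=> [x Kx] uK lK mK.
  have ix : (inf (K : set R) <= x)%R by exact: ge_inf.
  have xs : (x <= sup (K : set R))%R by exact: ub_le_sup.
  have iss := le_trans ix xs; split => //.
  rewrite -(leb_itv_bnd true false iss).
  apply: le_measure; rewrite ?inE// => y Ky /=.
  by rewrite in_itv/= ge_inf//= ub_le_sup.
have [iI leI] := lenle _ I0 uI lI mI; have [iJ leJ] := lenle _ J0 uJ lJ mJ.
rewrite -/i0 -/i1 in iI leI; rewrite -/j0 -/j1 in iJ leJ.
pose z0 := (t * i0 + (1 - t) * j0)%R; pose z1 := (t * i1 + (1 - t) * j1)%R.
have z01 : (z0 <= z1)%R by rewrite /z0 /z1; nra.
apply: (@le_trans _ _ (z1 - z0)%:E).
  rewrite (_ : z1 - z0 = t * (i1 - i0) + (1 - t) * (j1 - j0))%R; last by rewrite /z0 /z1; ring.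
  rewrite [leRHS]EFinD; apply: leeD; rewrite EFinM; apply: lee_wpmul2l => //; rewrite lee_fin; lra.
rewrite -(leb_itv_bnd false true z01).
apply: le_measure; rewrite ?inE// => z /=; rewrite in_itv/= => /andP[z0z zz1].
have z01' : (0 < z1 - z0)%R by lra.
pose u := ((z - z0) / (z1 - z0))%R.
have u01 : (0 < u < 1)%R.
  apply/andP; split; first by apply: divr_gt0; lra.
  by rewrite ltr_pdivrMr// mul1r ltrD2r.
rewrite (_ : z = t * ((1 - u) * i0 + u * i1) + (1 - t) * ((1 - u) * j0 + u * j1))%R.
  by apply: IJC; exact: interval_inf_sup.
transitivity (z0 + u * (z1 - z0))%R; first by rewrite /u divfK ?lt0r_neq0//; ring.
by rewrite /z0 /z1; ring.
Qed.

(** The area under the graph of [c], computed in both orders. The condition [0 <= r] lets [r] range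
    over the whole line. *)
Lemma layer_cake (c : R -> \bar R) : measurable_fun setT (c : measurableTypeR R -> _) ->
  (forall s, 0 <= c s) ->
  measurable_fun setT (fun r : measurableTypeR R => leb [set s : measurableTypeR R | (0 <= r)%R /\ r%:E < c s]) /\
  \int[leb]_s c s = \int[leb]_r leb [set s | (0 <= r)%R /\ r%:E < c s].
Proof.
move=> mc c0.
pose E : set (measurableTypeR R * measurableTypeR R) := [set p | (0 <= p.2)%R /\ p.2%:E < c p.1].
have mE : measurable E.
  rewrite (_ : E = (setT `*` `[0%R, +oo[%classic) `&` [set p | p.2%:E < c p.1]); last first.
    by apply/seteqP; split => -[s r] /=; rewrite in_itv/= andbT => -[] // [] //.
  apply: measurableI; first exact: measurableX.
  rewrite -[X in measurable X]setTI.
  apply: emeasurable_fun_lt.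
  - exact: measurableT.
  - by apply/measurable_EFinP; exact: measurable_snd.
  - exact: (measurableT_comp mc measurable_fst).
split.
  have := measurable_fun_ysection leb mE.
  by apply: eq_measurable_fun => r _ /=; congr (leb _); rewrite ysectionE.
transitivity ((leb \x leb) E).
  rewrite /product_measure1; apply: eq_integral => s _ /=.
  rewrite (_ : xsection E s = [set r | (0 <= r)%R /\ r%:E < c s]); last by rewrite xsectionE.
  have := c0 s; case: (c s) => [x| |//] x0.
    rewrite (_ : mkset _ = `[0%R, x[%classic); last first.
      apply/seteqP; split => r /=; rewrite in_itv/=; last by move=> /andP[].
      by move=> [-> ]; rewrite lte_fin.
    by rewrite leb_itv_bnd ?subr0.
  rewrite (_ : mkset _ = `[0%R, +oo[%classic); last first.
    apply/seteqP; split => r /=; rewrite in_itv/= andbT; first by case.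
    by move=> ->; split => //; rewrite ltry.
  by rewrite lebesgue_measure_itv/= ltry.
rewrite (product_measure_unique (m' := leb \x^ leb))//; last exact: product_measure2E.
rewrite /product_measure2; apply: eq_integral => s _ /=.
by congr (leb _); rewrite ysectionE.
Qed.

(* Integrate [brunn_minkowski1] over superlevel sets; this is where the
   normalization of [a] and [b] to supremum 1 is used. *)
Lemma prekopa_min (a b : R -> R) (c : R -> \bar R) (t : R) : (0 < t < 1)%R ->
  measurable_fun setT (a : measurableTypeR R -> R) ->
  measurable_fun setT (b : measurableTypeR R -> R) ->
  measurable_fun setT (c : measurableTypeR R -> _) -> (forall s, 0 <= c s) ->
  (forall s, 0 <= a s <= 1)%R -> (forall s, 0 <= b s <= 1)%R ->
  (forall r : R, (0 <= r < 1)%R -> exists s, (r < a s)%R) ->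
  (forall r : R, (0 <= r < 1)%R -> exists s, (r < b s)%R) ->
  (forall r : R, (0 <= r)%R -> cvx ([set s | (r < a s)%R] : set R^o)) ->
  (forall r : R, (0 <= r)%R -> cvx ([set s | (r < b s)%R] : set R^o)) ->
  (exists M : R, forall s, (0 < a s)%R -> (`|s| <= M)%R) ->
  (exists M : R, forall s, (0 < b s)%R -> (`|s| <= M)%R) ->
  (forall s s', (Num.min (a s) (b s'))%:E <= c (t * s + (1 - t) * s')%R) ->
  t%:E * \int[leb]_s (a s)%:E + (1 - t)%:E * \int[leb]_s (b s)%:E <= \int[leb]_s c s.
Proof.
move=> t01 ma mb mc c0 a01 b01 a1 b1 ca cb [Ma aM] [Mb bM] abc.
have mEa : measurable_fun setT (fun s : measurableTypeR R => (a s)%:E) by exact/measurable_EFinP.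
have mEb : measurable_fun setT (fun s : measurableTypeR R => (b s)%:E) by exact/measurable_EFinP.
have a0 s : 0 <= (a s)%:E by rewrite lee_fin; have /andP[] := a01 s.
have b0 s : 0 <= (b s)%:E by rewrite lee_fin; have /andP[] := b01 s.
have [mla ->] := layer_cake mEa a0; have [mlb ->] := layer_cake mEb b0.
have [mlc ->] := layer_cake mc c0.
have /andP[t0 t1] := t01.
have t1' : (0 <= 1 - t)%R by lra.
rewrite -!ge0_integralZl// ?lee_fin//; last exact: ltW.
rewrite -ge0_integralD//; last 4 first.
- by move=> r _; rewrite mule_ge0// lee_fin ltW.
- exact: measurable_funeM.
- by move=> r _; rewrite mule_ge0// lee_fin; lra.
- exact: measurable_funeM.
apply: ge0_le_integral => //.
- by move=> r _; rewrite adde_ge0// mule_ge0// lee_fin; lra.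
- by apply: emeasurable_funD; exact: measurable_funeM.
move=> r _.
have empty (f : R -> \bar R) : (forall s, ~ ((0 <= r)%R /\ r%:E < f s)) -> leb [set s | (0 <= r)%R /\ r%:E < f s] = 0.
  by move=> h; rewrite (_ : mkset _ = set0) ?measure0//; apply/seteqP; split => // s /h.
(* For [r] outside [[0, 1)] the superlevel sets of [a] and [b] are empty; for [r] inside, both are
   nonempty, as [brunn_minkowski1] requires. *)
have [r0|r0] : (r < 0)%R \/ (0 <= r)%R by case: (ltP r 0%R); [left|right].
  by rewrite (empty (fun s => (a s)%:E)) ?(empty (fun s => (b s)%:E)) ?mule0 ?adde0// => s [+ _]; rewrite leNgt r0.
have [r1|r1] : (1 <= r)%R \/ (r < 1)%R by case: (ltP r 1%R); [right|left].
  rewrite (empty (fun s => (a s)%:E)); last first.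
    by move=> s []; rewrite lte_fin => _; have /andP[_ h] := a01 s; rewrite ltNge (le_trans h r1).
  rewrite (empty (fun s => (b s)%:E)) ?mule0 ?adde0//.
  by move=> s []; rewrite lte_fin => _; have /andP[_ h] := b01 s; rewrite ltNge (le_trans h r1).
have seteq (f : R -> R) : [set s : measurableTypeR R | (0 <= r)%R /\ r%:E < (f s)%:E] = [set s | (r < f s)%R].
  by apply/seteqP; split => s /=; rewrite lte_fin; [case|].
rewrite !seteq (_ : [set s | _ /\ r%:E < c s] = [set s : measurableTypeR R | r%:E < c s]); last first.
  by apply/seteqP; split => s /=; [case|].
have mlt (f : R -> R) : measurable_fun setT (f : measurableTypeR R -> R) ->
    measurable [set s : measurableTypeR R | (r < f s)%R].
  move=> mf; rewrite -[X in measurable X]setTI.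
  have := mf measurableT `]r, +oo[%classic.
  by rewrite (_ : f @^-1` _ = [set s | (r < f s)%R])//; [apply|apply/seteqP; split => s /=; rewrite in_itv/= andbT].
have bnd (f : R -> R) (M : R) : (forall s, (0 < f s)%R -> (`|s| <= M)%R) ->
   has_ubound [set s | (r < f s)%R] /\ has_lbound [set s | (r < f s)%R].
  by move=> fM; split; [exists M|exists (- M)%R] => s /= rs; have := fM s (le_lt_trans r0 rs); rewrite ler_norml => /andP[].
have [ua la] := bnd a Ma aM; have [ub lb] := bnd b Mb bM.
apply: brunn_minkowski1 => //.
- exact: ca.
- exact: cb.
- by apply: a1; rewrite r0.
- by apply: b1; rewrite r0.
- exact: mlt.
- exact: mlt.
- rewrite -[X in measurable X]setTI; apply: emeasurable_fun_lt => //.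
- move=> x y /= rx ry; apply: lt_le_trans (abc x y).
  by rewrite lte_fin lt_min rx ry.
Qed.
End prekopa.

(** * Brunn-Minkowski in all dimensions *)

Section brunn_minkowski.
Local Open Scope ereal_scope.
Context {R : realType}.
Notation mu n := (@lebesgue_measure_rV R n).
Notation leb := (@lebesgue_measure R).

(** Young's inequality with exponents [1 / t] and [1 / (1 - t)], applied to the two powers. *)
Lemma weighted_AGM (x y t : R) : (0 <= x)%R -> (0 <= y)%R -> (0 < t < 1)%R ->
  (x `^ t * y `^ (1 - t) <= t * x + (1 - t) * y)%R.
Proof.
move=> x0 y0 /andP[t0 t1].
have t1' : (0 < 1 - t)%R by lra.
have := @conjugate_powR R (x `^ t)%R (y `^ (1 - t))%R t^-1%R (1 - t)^-1%R.
rewrite !powR_ge0 !invr_gt0 !invrK -!powRrM !mulfV ?lt0r_neq0// !powRr1//.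
by rewrite (mulrC x) (mulrC y); apply => //; ring.
Qed.

Lemma powR_invl (x t : R) : (0 <= x)%R -> (x^-1 `^ t = (x `^ t)^-1)%R.
Proof. by move=> x0; rewrite -powR_inv1// -powRrM mulN1r powRN. Qed.

Definition bounded_by n (A : set 'rV[R]_n) (r : R) := forall x, A x -> forall i, (`|x ord0 i| <= r)%R.

(* The multiplicative form, by induction on the dimension: the section volumes
   are rescaled to have supremum 1, fed to [prekopa_min], and AM-GM concludes. *)
Lemma brunn_minkowski n (A B C : set 'rV[R]_n) r t : (0 < t < 1)%R ->
  measurable A -> measurable B -> measurable C ->
  cvx A -> cvx B -> bounded_by A r -> bounded_by B r ->
  (forall x y, A x -> B y -> C (t *: x + (1 - t) *: y)%R) ->
  (fine (mu n A) `^ t * fine (mu n B) `^ (1 - t))%:E <= mu n C.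
Proof.
elim: n A B C r t => [|n IHn] A B C r t t01 mA mB mC cA cB rA rB ABC; have /andP[t0 t1] := t01.
  (* In dimension 0 the measure is the Dirac mass at 0; both exponents are nonzero, so a null set
     makes the left side vanish. *)
  rewrite /= !diracE/= !indicE.
  have [A0|A0] := boolP (0%R \in A); last by rewrite /= powR0 ?lt0r_neq0// mul0r lee_fin ler0n.
  have [B0|B0] := boolP (0%R \in B); last by rewrite /= mulrC powR0 ?mul0r ?lee_fin ?ler0n// subr_eq0 gt_eqF.
  rewrite (_ : 0%R \in C) /= ?powR1 ?mul1r//.
  by rewrite inE; have := ABC 0%R 0%R; rewrite !scaler0 addr0; apply; exact/set_mem.
pose sec (A : set 'rV[R]_n.+1) (s : R) := [set y : 'rV[R]_n | A (cons_rV (s, y))].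
have cons_cvx (u s s' : R) (y y' : 'rV[R]_n) :
    cons_rV ((u * s + (1 - u) * s')%R, (u *: y + (1 - u) *: y')%R) =
    (u *: cons_rV (s, y) + (1 - u) *: cons_rV (s', y'))%R :> 'rV[R]_n.+1.
  by rewrite -!cons_rVZ -cons_rVD.
have msec D s : measurable D -> measurable (sec D s) by exact: measurable_section.
have csec D s : cvx D -> cvx (sec D s).
  move=> cD y y' u u0 u1 Dy Dy'; rewrite /sec/=.
  rewrite [X in cons_rV (X, _)](_ : s = u * s + (1 - u) * s)%R; last by ring.
  by rewrite cons_cvx; exact: cD.
have rsec D s : bounded_by D r -> bounded_by (sec D s) r.
  by move=> rD y /rD Dy i; have := Dy (lift ord0 i); rewrite cons_rVS.
have secr D s : bounded_by D r -> sec D s !=set0 -> (`|s| <= r)%R.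
  by move=> rD [y /rD/(_ ord0)]; rewrite cons_rV0.
pose L : R := fine (mu n [set x | forall i, `[(- r)%R, r]%classic (x ord0 i)]).
have box_lty : mu n [set x | forall i, `[(- r)%R, r]%classic (x ord0 i)] < +oo.
  apply: (@lebesgue_measure_rV_bounded _ _ _ r).
    exact: (measurable_forall_rV (A := fun=> `[(- r)%R, r]%classic)).
  by move=> x xr i; have := xr i; rewrite /= in_itv/= -ler_norml.
have secL D s : measurable D -> bounded_by D r -> mu n (sec D s) <= L%:E.
  move=> mD rD; rewrite /L fineK ?ge0_fin_numE//.
  apply: le_measure; rewrite ?inE; [exact: msec| |].
    exact: (measurable_forall_rV (A := fun=> `[(- r)%R, r]%classic)).
  by move=> y Dy i; have := rsec D s rD y Dy i; rewrite /= in_itv/= -ler_norml.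
have secfin D s : measurable D -> bounded_by D r -> mu n (sec D s) = (fine (mu n (sec D s)))%:E.
  by move=> mD rD; rewrite fineK// ge0_fin_numE// (le_lt_trans (secL D s mD rD))// ltry.
pose f (D : set 'rV[R]_n.+1) (s : R) := fine (mu n (sec D s)).
have f0 D s : (0 <= f D s)%R by exact: fine_ge0.
have muf D : measurable D -> bounded_by D r -> mu n.+1 D = \int[leb]_s (f D s)%:E.
  by move=> mD rD; rewrite lebesgue_measure_rVS; apply: eq_integral => s _; exact: secfin.
have mf D : measurable D -> measurable_fun setT (f D : measurableTypeR R -> R).
  move=> mD; apply: (measurableT_comp (fine_measurable measurableT)) => //.
  exact: measurable_measure_section.
have fL D s : measurable D -> bounded_by D r -> (f D s <= L)%R.
  by move=> mD rD; rewrite -lee_fin -secfin//; exact: secL.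
have normalize (D : set 'rV[R]_n.+1) : measurable D -> cvx D -> bounded_by D r -> mu n.+1 D != 0 ->
    let al := sup (range (f D)) in
    [/\ (0 < al)%R, forall s, (0 <= f D s / al <= 1)%R,
      forall r : R, (0 <= r < 1)%R -> exists s, (r < f D s / al)%R,
      forall r : R, (0 <= r)%R -> cvx ([set s | (r < f D s / al)%R] : set R^o) &
      (exists M : R, forall s, (0 < f D s / al)%R -> (`|s| <= M)%R)].
  move=> mD cD rD D0 al.
  have fub : has_ubound (range (f D)) by exists L => _ [s _ <-]; exact: fL.
  have fal s : (f D s <= al)%R by apply: ub_le_sup => //; exists s.
  have al0 : (0 < al)%R.
    rewrite lt_neqAle (le_trans (f0 D 0%R))// andbT eq_sym.
    apply: contra D0 => /eqP al0; rewrite muf// integral0_eq// => s _.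
    by congr _%:E; apply/eqP; rewrite eq_le f0 -al0 fal.
  split => //.
  - by move=> s; rewrite divr_ge0 ?(ltW al0)//= ler_pdivrMr// mul1r.
  - move=> u /andP[u0 u1].
    have [_ [s _ <-] us] : exists2 x, range (f D) x & (u * al < x)%R.
      apply: sup_gt; first by exists (f D 0%R), 0%R.
      by rewrite -/al gtr_pMl.
    by exists s; rewrite ltr_pdivlMr.
  - move=> u u0 s s' l l0 l1 /=.
    rewrite !ltr_pdivlMr// => us us'.
    have [->|ln1] := eqVneq l 1%R; first by rewrite scale1r subrr scale0r addr0.
    have [->|ln0] := eqVneq l 0%R; first by rewrite scale0r subr0 scale1r add0r.
    have l01 : (0 < l < 1)%R by rewrite !lt_neqAle eq_sym ln0 l0 ln1 l1.
    (* The induction hypothesis on slices of [D] bounds the intermediate slice volume below by a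
       geometric mean, hence by a minimum: superlevel sets of [f D] are convex. *)
    have := IHn (sec D s) (sec D s') (sec D (l * s + (1 - l) * s')%R) r l l01.
    move=> /(_ (msec _ _ mD) (msec _ _ mD) (msec _ _ mD) (csec _ _ cD) (csec _ _ cD) (rsec _ _ rD) (rsec _ _ rD)).
    rewrite [X in _ <= X]secfin// lee_fin -!/(f D _) => IH.
    apply: (@lt_le_trans _ _ (f D s `^ l * f D s' `^ (1 - l))%R); last first.
      by apply: IH => y y' Dy Dy'; rewrite /sec/= cons_cvx; apply: cD.
    pose m := Num.min (f D s) (f D s').
    have um : (u * al < m)%R by rewrite lt_min us us'.
    have m0 : (0 < m)%R by apply: le_lt_trans um; rewrite mulr_ge0// ltW.
    apply: (lt_le_trans um).
    have -> : m = (m `^ l * m `^ (1 - l))%R.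
      rewrite -powRD; first by rewrite subrKC powRr1// ltW.
      by rewrite (gt_eqF m0) implybT.
    by apply: ler_pM; rewrite ?powR_ge0//; apply: ge0_ler_powR;
       rewrite ?nnegrE ?subr_ge0 ?(ltW m0) ?ge_min ?lexx ?orbT.
  - exists r => s; rewrite ltr_pdivlMr// mul0r => fs.
    apply: (secr D) => //; apply: contrapT => /nonemptyPn e; move: fs.
    by rewrite /f e measure0 ltxx.
have [A0|A0] := eqVneq (mu n.+1 A) 0.
  by rewrite A0 /= powR0 ?lt0r_neq0// mul0r.
have [B0|B0] := eqVneq (mu n.+1 B) 0.
  by rewrite B0 /= [X in (_ * X)%R]powR0 ?mulr0// subr_eq0 gt_eqF.
have := normalize A mA cA rA A0; set al := sup _ => -[al0 A1 A2 A3 A4].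
have := normalize B mB cB rB B0; set be := sup _ => -[be0 B1 B2 B3 B4].
(* Dividing by [k] matches the two normalizations: the geometric mean of [f A s / al] and
   [f B s' / be] is at least their minimum, and [k] cancels both suprema at the end. *)
pose k := (al `^ t * be `^ (1 - t))%R.
have k0 : (0 < k)%R by rewrite mulr_gt0// powR_gt0.
pose c (s : R) := k^-1%:E * mu n (sec C s).
have c0 s : 0 <= c s by rewrite mule_ge0// lee_fin invr_ge0 ltW.
have mc : measurable_fun setT (c : measurableTypeR R -> _).
  by apply: measurable_funeM; exact: measurable_measure_section.
have mnf D (a : R) : measurable D -> measurable_fun setT ((fun s => f D s / a)%R : measurableTypeR R -> R).
  by move=> mD; apply: measurable_funM => //; exact: mf.
have := prekopa_min t01 (mnf A al mA) (mnf B be mB) mc c0 A1 B1 A2 B2 A3 B3 A4 B4.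
have intf D (a : R) : (0 < a)%R -> measurable D -> bounded_by D r ->
    \int[leb]_s (f D s / a)%:E = (fine (mu n.+1 D) / a)%:E.
  move=> a0 mD rD; under eq_integral do rewrite mulrC EFinM.
  rewrite ge0_integralZl//; last 3 first.
  - by apply/measurable_EFinP; exact: mf.
  - by move=> s _; rewrite lee_fin f0.
  - by rewrite lee_fin invr_ge0 ltW.
  rewrite -muf// mulrC EFinM fineK// ge0_fin_numE//.
  exact: (@lebesgue_measure_rV_bounded _ _ _ r).
rewrite !intf//.
have -> : \int[leb]_s c s = k^-1%:E * mu n.+1 C.
  rewrite lebesgue_measure_rVS ge0_integralZl ?lee_fin ?invr_ge0 ?(ltW k0)//.
  exact: measurable_measure_section.
have intC (s s' : R) : (Num.min (f A s / al) (f B s' / be))%:E <= c (t * s + (1 - t) * s')%R.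
  have := IHn (sec A s) (sec B s') (sec C (t * s + (1 - t) * s')%R) r t t01.
  move=> /(_ (msec _ _ mA) (msec _ _ mB) (msec _ _ mC) (csec _ _ cA) (csec _ _ cB) (rsec _ _ rA) (rsec _ _ rB)).
  rewrite -/(f A s) -/(f B s') => IH.
  apply: (@le_trans _ _ (k^-1%:E * (f A s `^ t * f B s' `^ (1 - t))%:E)); last first.
    apply: lee_wpmul2l; first by rewrite lee_fin invr_ge0 ltW.
    by apply: IH => y y' Dy Dy'; rewrite /sec/= cons_cvx; apply: ABC.
  rewrite -EFinM lee_fin.
  set m := Num.min _ _.
  have m0 : (0 <= m)%R by rewrite le_min; have /andP[-> _] := A1 s; have /andP[] := B1 s'.
  have -> : (k^-1 * (f A s `^ t * f B s' `^ (1 - t)) = (f A s / al) `^ t * (f B s' / be) `^ (1 - t))%R.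
    rewrite !powRM ?invr_ge0 ?(ltW al0) ?(ltW be0)// /k !powR_invl ?ltW//.
    rewrite invfM; ring.
  have [->|mn0] := eqVneq m 0%R; first by rewrite mulr_ge0// powR_ge0.
  have -> : m = (m `^ t * m `^ (1 - t))%R.
    by rewrite -powRD ?mn0 ?implybT// subrKC powRr1.
  have /andP[A1s _] := A1 s; have /andP[B1s _] := B1 s'.
  by apply: ler_pM; rewrite ?powR_ge0//; apply: ge0_ler_powR;
     rewrite ?nnegrE ?subr_ge0 ?m0 ?ge_min ?lexx ?orbT ?(ltW t0) ?(ltW t1).
move=> /(_ intC); rewrite -!EFinM -EFinD => H.
have kN : (k != 0)%R by rewrite gt_eqF.
have -> : mu n.+1 C = k%:E * (k^-1%:E * mu n.+1 C) by rewrite muleA -EFinM mulfV// mul1e.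
apply: le_trans (lee_wpmul2l _ H); last by rewrite lee_fin ltW.
rewrite -EFinM lee_fin.
have xA : (0 <= fine (mu n.+1 A) / al)%R by rewrite divr_ge0 ?fine_ge0// ltW.
have xB : (0 <= fine (mu n.+1 B) / be)%R by rewrite divr_ge0 ?fine_ge0// ltW.
apply: le_trans (ler_wpM2l (ltW k0) (weighted_AGM xA xB t01)).
rewrite !powRM ?fine_ge0 ?invr_ge0 ?(ltW al0) ?(ltW be0)// (powR_invl _ (ltW al0)) (powR_invl _ (ltW be0)).
rewrite /k mulrACA (mulrC (al `^ t)%R) divfK ?gt_eqF ?powR_gt0//.
by rewrite (mulrC (be `^ _)%R) divfK// gt_eqF ?powR_gt0.
Qed.
End brunn_minkowski.

(** * Integration over compact sets *)

Section compact_integral.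
Context {R : realType} {n : nat}.
Notation mu := (@lebesgue_measure_rV R n).
Implicit Types (K : set 'rV[R]_n) (f g : 'rV[R]_n -> R).

Lemma integrable_compact K f : compact K -> continuous f ->
  mu.-integrable K (EFin \o f).
Proof.
move=> cK cf; apply: measurable_bounded_integrable.
- exact: compact_measurable_rV.
- exact: compact_measure_lty.
- exact: measurable_funTS (continuous_measurable_rV cf).
- have cfK : compact (f @` K) by apply: continuous_compact => //; exact: continuous_subspaceT.
  have [M [Mr MfK]] := compact_bounded cfK.
  by exists M; split => // x Mx y Ky /=; apply: MfK => //; exists y.
Qed.

Definition dot (x y : 'rV[R]_n) := \sum_i x ord0 i * y ord0 i.

Lemma dotC x y : dot x y = dot y x.
Proof. by apply: eq_bigr => i _; rewrite mulrC. Qed.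

Lemma dotDr x y z : dot x (y + z) = dot x y + dot x z.
Proof. by rewrite -big_split/=; apply: eq_bigr => i _; rewrite mxE mulrDr. Qed.

Lemma dotZr x a y : dot x (a *: y) = a * dot x y.
Proof. by rewrite mulr_sumr; apply: eq_bigr => i _; rewrite mxE mulrCA. Qed.

Lemma dotNr x y : dot x (- y) = - dot x y.
Proof. by rewrite -scaleN1r dotZr mulN1r. Qed.

Lemma dotBr x y z : dot x (y - z) = dot x y - dot x z.
Proof. by rewrite dotDr dotNr. Qed.

Lemma dot_ge0 x : 0 <= dot x x.
Proof. by apply: sumr_ge0 => i _; rewrite -expr2 sqr_ge0. Qed.

Lemma coord_sqr_le_dot (x : 'rV[R]_n) (i : 'I_n) : x ord0 i ^+ 2 <= dot x x.
Proof.
rewrite /dot (bigD1 i)//= -expr2 lerDl; apply: sumr_ge0 => j _.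
by rewrite -expr2 sqr_ge0.
Qed.

Lemma dotDZ x y t : dot (x + t *: y) (x + t *: y) = dot x x + 2 * t * dot x y + t ^+ 2 * dot y y.
Proof.
rewrite dotDr dotZr !(dotC (_ + _)) !dotDr !dotZr (dotC y x); ring.
Qed.

Lemma continuous_cst (a : R) : continuous (fun _ : 'rV[R]_n => a).
Proof. exact: cst_continuous. Qed.

Lemma continuous_coord (i : 'I_n) : continuous (fun x : 'rV[R]_n => x ord0 i).
Proof. exact: coord_continuous. Qed.

Lemma continuous_funD f g : continuous f -> continuous g -> continuous (fun x => f x + g x).
Proof. by move=> cf cg x; exact: (continuousD (cf x) (cg x)). Qed.

Lemma continuous_funM f g : continuous f -> continuous g -> continuous (fun x => f x * g x).
Proof. by move=> cf cg x; exact: (continuousM (cf x) (cg x)). Qed.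

Lemma continuous_sum (I : Type) (s : seq I) (h : I -> 'rV[R]_n -> R) :
  (forall i, continuous (h i)) -> continuous (fun x => \sum_(i <- s) h i x).
Proof.
move=> ch; elim: s => [|i s IHs].
  have -> : (fun x => \sum_(i <- [::]) h i x) = cst 0 by apply/funext => x; rewrite big_nil.
  exact: cst_continuous.
have -> : (fun x => \sum_(i <- i :: s) h i x) = (fun x => h i x + \sum_(i <- s) h i x).
  by apply/funext => x; rewrite big_cons.
exact: continuous_funD.
Qed.

Lemma continuous_dot x : continuous (dot x).
Proof.
apply: continuous_sum => i.
exact: (continuous_funM (@continuous_cst (x ord0 i)) (@continuous_coord i)).
Qed.

Lemma Rintegral_sum (D : set 'rV[R]_n) (I : Type) (s : seq I) (h : I -> 'rV[R]_n -> R) :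
  measurable D -> (forall i, mu.-integrable D (EFin \o h i)) ->
  \int[mu]_(x in D) (\sum_(i <- s) h i x) = \sum_(i <- s) \int[mu]_(x in D) h i x.
Proof.
move=> mD ih.
have ihs t : mu.-integrable D (EFin \o (fun x => \sum_(i <- t) h i x)).
  rewrite (_ : _ \o _ = fun x => \sum_(i <- t) (h i x)%:E)%E; last first.
    by apply/funext => x /=; rewrite sumEFin.
  by apply: integrable_sum => // i _; exact: ih.
elim: s => [|i s IHs].
  under eq_Rintegral do rewrite big_nil.
  by rewrite Rintegral_cst ?mul0r ?big_nil.
under eq_Rintegral do rewrite big_cons.
by rewrite RintegralD ?big_cons ?IHs.
Qed.

End compact_integral.

(** * Halfspaces near the barycenter *)

Section halfspace.
Context {R : realType} {n : nat}.
Notation mu := (@lebesgue_measure_rV R n).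
Implicit Types (K : set 'rV[R]_n).

Lemma scales_homothety (a : R) (v : 'rV[R]_n) : a != 0 ->
  scales mu (fun x => a *: x + v) (`|a|^-1 ^+ n).
Proof.
move=> a0.
have ua : (a%:M : 'M[R]_n) \in unitmx by rewrite unitmxE det_scalar unitfE expf_neq0.
have := scales_comp (scales_mulmx ua) (scales_translate v).
rewrite det_scalar normrX -exprVn mulr1; congr (scales _ _ _).
by apply/funext => x /=; rewrite mul_mx_scalar.
Qed.

(* If -h is the minimum of the linear form on K, Markov's inequality puts half of
   K in the slab [dot th x <= h + 2 * eps], which the homothety of ratio 1/2 at a
   minimizer maps into the halfspace. *)
Lemma halfspace_measure K th eps : compact K -> cvx K -> K !=set0 ->
  \int[mu]_(x in K) dot th x = 0 -> 0 < eps ->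
  (mu K <= (2 ^+ n.+1)%:E * mu (K `&` [set x | (dot th x <= eps)%R]))%E.
Proof.
move=> cK cvK K0 int0 eps0.
have mK := compact_measurable_rV cK.
have cth := @continuous_dot R n th.
have mle (a : R) : measurable [set x : 'rV[R]_n | (dot th x <= a)%R].
  have := continuous_measurable_rV cth measurableT (measurable_itv `]-oo, a]).
  rewrite setTI.
  by rewrite (_ : dot th @^-1` _ = [set x | (dot th x <= a)%R])//; apply/seteqP; split => x /=; rewrite in_itv/=.
have finK : mu K \is a fin_num by rewrite ge0_fin_numE//; exact: compact_measure_lty.
have [p /set_mem Kp pmin] : exists2 p, p \in K & forall x, x \in K -> dot th p <= dot th x.
  by apply: compact_EVT_min => //; exact: continuous_subspaceT.
pose h := - dot th p.
pose V := fine (mu K).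
have VE : mu K = V%:E by rewrite fineK.
have [V0|V0] := leP V 0.
  by rewrite VE; apply: (@le_trans _ _ 0%E); rewrite ?lee_fin// mule_ge0// lee_fin exprn_ge0.
have inth : \int[mu]_(x in K) (dot th x + h) = h * V.
  rewrite RintegralD// ?int0 ?add0r ?Rintegral_cst//; apply: integrable_compact => //.
  exact: cst_continuous.
have inthE : (\int[mu]_(x in K) (dot th x + h)%:E = (h * V)%:E)%E.
  rewrite -inth /Rintegral fineK//; apply: integrable_fin_num => //.
  by apply: (@integrable_compact _ _ K (fun x => dot th x + h)) => //; exact: (continuous_funD cth (@continuous_cst _ _ h)).
have th0 x : K x -> 0 <= dot th x + h.
  by move=> Kx; rewrite /h subr_ge0; apply: pmin; exact: mem_set.
have hV0 : 0 <= h * V by rewrite -inth; apply: Rintegral_ge0.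
have h0 : 0 <= h by rewrite -(pmulr_lge0 _ V0).
pose Q := K `&` [set x | (dot th x <= h + 2 * eps)%R].
have mQ : measurable Q by exact: measurableI.
have finQ : mu Q \is a fin_num.
  by rewrite ge0_fin_numE// (le_lt_trans _ (compact_measure_lty cK))// le_measure ?inE//; exact: subIsetl.
have finD : mu (K `\` Q) \is a fin_num.
  by rewrite ge0_fin_numE// (le_lt_trans _ (compact_measure_lty cK))// le_measure ?inE//; exact: measurableD.
pose q := fine (mu Q); pose d := fine (mu (K `\` Q)).
have Vqd : V = d + q.
  apply: EFin_inj; rewrite -VE EFinD !fineK// (measureDI mu mK mQ); congr (_ + mu _)%E.
  by rewrite setIA setIid.
have d0 : 0 <= d by exact: fine_ge0.
have q0 : 0 <= q by exact: fine_ge0.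
(* Off [Q] the integrand exceeds [2 * h + 2 * eps]; the slack [eps] keeps this threshold positive
   even when [h = 0]. *)
have markov : (2 * h + 2 * eps) * d <= h * V.
  rewrite -lee_fin -inthE.
  apply: (@le_trans _ _ (\int[mu]_(x in K `\` Q) (dot th x + h)%:E)%E); last first.
    apply: ge0_subset_integral => //.
    - exact: measurableD.
    - apply/measurable_EFinP; apply: measurable_funD => //.
      exact: measurable_funTS (continuous_measurable_rV cth).
  rewrite EFinM fineK// -integral_cst; last exact: measurableD.
  apply: ge0_le_integral.
  - exact: measurableD.
  - by move=> x _; rewrite lee_fin; lra.
  - exact: measurable_cst.
  - apply/measurable_EFinP; apply: measurable_funD => //.
    exact: measurable_funTS (continuous_measurable_rV cth).
  - move=> x [Kx nQ]; rewrite lee_fin; apply/ltW; rewrite ltNge; apply/negP => xh.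
    by apply: nQ; split => //=; lra.
have qV : V <= 2 * q.
  nra.
have half0 : (2^-1 : R) != 0 by rewrite invr_neq0.
have KQ : (mu Q <= (2 ^+ n)%:E * mu (K `&` [set x | (dot th x <= eps)%R]))%E.
  have [mT _ sc] := scales_homothety (2^-1 *: p) half0.
  have a2 : (`|2^-1 : R|^-1 ^+ n = 2 ^+ n)%R by rewrite ger0_norm ?invr_ge0// invrK.
  rewrite -a2 -sc; last exact: measurableI.
  apply: le_measure; rewrite ?inE//.
    by rewrite -[X in measurable X]setTI; apply: mT => //; exact: measurableI.
  move=> x [Kx /= xh]; split => /=.
    have := cvK x p 2^-1 _ _ Kx Kp.
    by rewrite (_ : 1 - 2^-1 = 2^-1 :> R); [apply; lra|lra].
  by rewrite dotDr !dotZr; move: xh; rewrite /h; lra.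
rewrite exprS EFinM -muleA; apply: le_trans (lee_wpmul2l _ KQ) => //.
by rewrite VE -(fineK finQ) -EFinM lee_fin.
Qed.
End halfspace.

(** * Intersection of a body with its reflections *)

Section central_symmetry.
Context {R : realType} {n : nat}.
Notation mu := (@lebesgue_measure_rV R n).
Implicit Types (K : set 'rV[R]_n).

(** [K] intersected with its reflection in the point [x / 2]. As a function of [x], its measure is
    the convolution of the indicator of [K] with itself. *)
Definition refl K (x : 'rV[R]_n) := K `&` [set y | K (x - y)].

Lemma measurable_subrV : measurable_fun setT (fun p : 'rV[R]_n * 'rV[R]_n => p.1 - p.2).
Proof.
apply: measurable_fun_rVP => i; under eq_fun do rewrite !mxE.
apply: measurable_funB.
  exact: (measurableT_comp (measurable_coord_rV i) measurable_fst).
exact: (measurableT_comp (measurable_coord_rV i) measurable_snd).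
Qed.

Lemma measurable_refl_graph K : measurable K ->
  measurable [set p : 'rV[R]_n * 'rV[R]_n | refl K p.1 p.2].
Proof.
move=> mK; rewrite (_ : mkset _ = (snd @^-1` K) `&` ((fun p => p.1 - p.2) @^-1` K))//.
apply: measurableI; rewrite -[X in measurable X]setTI; first exact: measurable_snd.
exact: measurable_subrV.
Qed.

Lemma measurable_refl K x : measurable K -> measurable (refl K x).
Proof.
move=> mK; have := measurable_xsection x (measurable_refl_graph mK).
by rewrite xsectionE.
Qed.

(** The midpoint of [y] and [x - y]. This confines the [x] with nonempty intersection to [2 K],
    whose measure is [2 ^ n] times that of [K]. *)
Lemma refl_half K x y : cvx K -> refl K x y -> K (2^-1 *: x).
Proof.
move=> cK [Ky Kxy]; have := cK y (x - y) 2^-1 _ _ Ky Kxy.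
rewrite (_ : 1 - 2^-1 = 2^-1 :> R); last by lra.
rewrite -scalerDr [y + _]addrC subrK; apply; lra.
Qed.

Lemma refl_cvx K x : cvx K -> cvx (refl K x).
Proof.
move=> cK y z t t0 t1 [Ky Kxy] [Kz Kxz]; split; first exact: cK.
rewrite /= (_ : x - _ = t *: (x - y) + (1 - t) *: (x - z)); first exact: cK.
rewrite !scalerBr opprD addrACA -scalerDl [t + _]addrC subrK scale1r.
by [].
Qed.

(** Combinations of points of the two intersections lie in the intersection at the combined point;
    Brunn-Minkowski bounds its measure below by a geometric mean of two numbers that are at least
    [v]. *)
Lemma refl_measure_quasiconcave K x y t (v : R) : compact K -> cvx K ->
  0 <= t -> t <= 1 -> 0 < v ->
  (v%:E <= mu (refl K x))%E -> (v%:E <= mu (refl K y))%E ->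
  (v%:E <= mu (refl K (t *: x + (1 - t) *: y)))%E.
Proof.
move=> cK cvK t0 t1 v0 vx vy.
have [->|tn1] := eqVneq t 1; first by rewrite scale1r subrr scale0r addr0.
have [->|tn0] := eqVneq t 0; first by rewrite scale0r subr0 scale1r add0r.
have t01 : 0 < t < 1 by rewrite !lt_neqAle eq_sym tn0 t0 tn1 t1.
have mK := compact_measurable_rV cK.
have [r _ rK] := compact_coord_bounded cK.
have rrefl z : bounded_by (refl K z) r by move=> u [/rK].
have finr z : mu (refl K z) = (fine (mu (refl K z)))%:E.
  by rewrite fineK// ge0_fin_numE//; apply: lebesgue_measure_rV_bounded (rrefl z); exact: measurable_refl.
have := brunn_minkowski t01 (measurable_refl x mK) (measurable_refl y mK)
   (measurable_refl (t *: x + (1 - t) *: y) mK) (refl_cvx cvK) (refl_cvx cvK) (rrefl x) (rrefl y).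
move=> BM; apply: le_trans (BM _); last first.
  move=> a b [Ka Kxa] [Kb Kyb]; split; first exact: cvK.
  rewrite /= (_ : _ - _ = t *: (x - a) + (1 - t) *: (y - b)); first exact: cvK.
  by rewrite !scalerBr opprD addrACA.
rewrite lee_fin; have := vx; rewrite finr lee_fin => {}vx; have := vy; rewrite finr lee_fin => {}vy /=.
have -> : v = v `^ t * v `^ (1 - t).
  by rewrite -powRD ?(gt_eqF v0) ?implybT// subrKC powRr1// ltW.
by apply: ler_pM; rewrite ?powR_ge0//; apply: ge0_ler_powR;
     rewrite ?nnegrE ?subr_ge0 ?(ltW v0) ?fine_ge0.
Qed.

(* Otherwise the pairs (x, y) with y and x - y in K and [dot th x <= 2 * eps] have
   too small a measure by Tonelli: they include all pairs with y and x - y in the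
   part of K in the halfspace, and x/2 always lies in K. *)
Lemma refl_measure_halfspace K th eps : (1 <= n)%N -> compact K -> cvx K -> (0 < mu K)%E ->
  \int[mu]_(x in K) dot th x = 0 -> 0 < eps ->
  exists2 x, dot th x <= 2 * eps & ((2 ^- (6 * n))%:E * mu K <= mu (refl K x))%E.
Proof.
(* Origin of [6 * n]: two halfspace bounds cost [2 ^ n.+1] each, the size of [2 K] costs [2 ^ n],
   and the total exponent [3 n + 2] is strictly below [6 n] once [n] is positive. *)
move=> n1; have nn : (n.+1 + n.+1 + n < 6 * n)%N by lia.
move=> cK cvK K0 int0 eps0; apply: contrapT => H.
have mK := compact_measurable_rV cK.
have finK : mu K \is a fin_num by rewrite ge0_fin_numE//; exact: compact_measure_lty.
have Kn0 : K !=set0.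
  by apply: contrapT => /nonemptyPn e; move: K0; rewrite e measure0 ltxx.
pose V := fine (mu K).
have VE : mu K = V%:E by rewrite fineK.
have V0 : 0 < V by rewrite -lte_fin -VE.
pose v := 2 ^- (6 * n) * V.
have v0 : 0 < v by rewrite mulr_gt0// invr_gt0 exprn_gt0.
pose KH := K `&` [set x | dot th x <= eps].
have mle (a : R) : measurable [set x : 'rV[R]_n | (dot th x <= a)%R].
  have := continuous_measurable_rV (@continuous_dot R n th) measurableT (measurable_itv `]-oo, a]).
  rewrite setTI.
  by rewrite (_ : dot th @^-1` _ = [set x | (dot th x <= a)%R])//; apply/seteqP; split => x /=; rewrite in_itv/=.
have mKH : measurable KH by exact: measurableI.
pose E := [set p : 'rV[R]_n * 'rV[R]_n | refl K p.1 p.2] `&`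
          ([set x | dot th x <= 2 * eps] `*` setT).
have mE : measurable E by apply: measurableI; [exact: measurable_refl_graph|exact: measurableX].
have half0 : (2^-1 : R) != 0 by rewrite invr_neq0.
have m2K : mu [set x | K (2^-1 *: x)] = ((2 ^+ n) * V)%:E.
  have [_ _ sc] := scales_homothety (0 : 'rV[R]_n) half0.
  have : mu ((fun x => 2^-1 *: x + 0) @^-1` K) = ((`|2^-1 : R|^-1 ^+ n)%:E * mu K)%E by exact: sc.
  rewrite ger0_norm ?invr_ge0// invrK VE -EFinM => <-.
  by congr (mu _); apply/seteqP; split => x /=; rewrite addr0.
have mm2K : measurable [set x | K (2^-1 *: x)].
  have [mT _ _] := scales_homothety (0 : 'rV[R]_n) half0.
  rewrite (_ : mkset _ = setT `&` (fun x => 2^-1 *: x + 0) @^-1` K); first exact: mT.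
  by rewrite setTI; apply/seteqP; split => x /=; rewrite addr0.
have up : ((mu \x mu) E <= (v * (2 ^+ n * V))%:E)%E.
  rewrite /product_measure1 EFinM -m2K -integral_cst//.
  rewrite [leRHS]integral_mkcond.
  apply: ge0_le_integral => //.
  - exact: measurable_fun_xsection.
  - by apply/(measurable_restrictT _ mm2K); exact: measurable_cst.
  move=> x _; rewrite /= patchE.
  case: ifPn => [|/negP xK].
    rewrite inE => _; have [xe|xe] := leP (dot th x) (2 * eps).
      have -> : xsection E x = refl K x.
        by rewrite xsectionE; apply/seteqP; split => y /=; [case|].
      rewrite leNgt; apply/negP => h; apply: H; exists x => //.
      by rewrite VE -EFinM ltW.
    rewrite (_ : xsection E x = set0) ?measure0 ?lee_fin ?(ltW v0)//.
    rewrite xsectionE; apply/seteqP; split => y //= -[_ [/=]].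
    by rewrite leNgt xe.
  rewrite (_ : xsection E x = set0) ?measure0//.
  rewrite xsectionE; apply/seteqP; split => y //= -[Kxy _].
  by apply: xK; rewrite inE; exact: refl_half Kxy.
(* Over [y] in [KH] the fibre contains the translate [KH + y], on which the form is at most
   [eps + eps]; hence the level [2 * eps]. *)
have lo : (mu KH * mu KH <= (mu \x mu) E)%E.
  rewrite (product_measure_unique (m' := (mu \x^ mu)%E))//; last exact: product_measure2E.
  rewrite /product_measure2 (_ : (mu KH * mu KH = \int[mu]_(y in KH) cst (mu KH) y)%E); last by rewrite integral_cst.
  rewrite [leLHS]integral_mkcond.
  apply: ge0_le_integral => //.
  - by move=> y _; rewrite patchE; case: ifP.
  - by apply/(measurable_restrictT _ mKH); exact: measurable_cst.
  - exact: measurable_fun_ysection.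
  move=> y _; rewrite /= patchE.
  case: ifPn => [|/negP yK]; last exact: measure_ge0.
  rewrite inE => -[Ky /= ye].
  have [mT _ sc] := scales_translate (- y).
  have -> : mu KH = mu ((fun x => x + - y) @^-1` KH) by rewrite [RHS]sc ?mul1e.
  apply: le_measure; rewrite ?inE.
  - by rewrite -[X in measurable X]setTI; exact: mT.
  - exact: measurable_ysection.
  move=> x [/= Kxy xye]; rewrite ysectionE; split => //=; split => //=.
  by move: xye ye; rewrite dotBr; lra.
have := halfspace_measure cK cvK Kn0 int0 eps0; rewrite -/KH VE => hs.
have finH : mu KH \is a fin_num.
  by rewrite ge0_fin_numE// (le_lt_trans _ (compact_measure_lty cK))// le_measure ?inE//; exact: subIsetl.
move: hs up lo; rewrite -(fineK finH); set h := fine _ => hs up lo.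
have := le_trans lo up; rewrite -EFinM lee_fin => {}lo.
move: hs; rewrite -EFinM lee_fin => hs.
have h0 : 0 <= h by exact: fine_ge0.
have : V * V <= (2 ^+ n.+1 * h) * (2 ^+ n.+1 * h) by apply: ler_pM => //; exact: ltW.
rewrite mulrACA => hs2.
have : V * V <= 2 ^+ n.+1 * 2 ^+ n.+1 * (v * (2 ^+ n * V)).
  by apply: le_trans hs2 _; apply: ler_wpM2l => //; rewrite mulr_ge0 ?exprn_ge0.
apply/negP; rewrite -ltNge.
have -> : 2 ^+ n.+1 * 2 ^+ n.+1 * (v * (2 ^+ n * V)) = (2 ^+ (n.+1 + n.+1 + n) / 2 ^+ (6 * n)) * (V * V).
  by rewrite /v !exprD; ring.
rewrite gtr_pMl ?mulr_gt0// ltr_pdivrMr ?exprn_gt0// mul1r.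
by rewrite ltr_eXn2l ?ltr1n.
Qed.

(* The infimum of |x|^2 over admissible x cannot be positive: moving x towards an
   admissible point y with [dot x y <= dot x x / 2] decreases |x|^2 by a definite
   amount. *)
Lemma refl_measure_near0 K d : (1 <= n)%N -> compact K -> cvx K -> (0 < mu K)%E ->
  (forall th, \int[mu]_(x in K) dot th x = 0) -> 0 < d ->
  exists2 x, dot x x < d & ((2 ^- (6 * n))%:E * mu K <= mu (refl K x))%E.
Proof.
move=> n1 cK cvK K0 int0 d0; apply: contrapT => H.
have finK : mu K \is a fin_num by rewrite ge0_fin_numE//; exact: compact_measure_lty.
pose v := 2 ^- (6 * n) * fine (mu K).
have v0 : 0 < v by rewrite mulr_gt0// ?invr_gt0 ?exprn_gt0// fine_gt0// K0 -ge0_fin_numE.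
have vE : ((2 ^- (6 * n))%:E * mu K = v%:E)%E by rewrite EFinM fineK.
pose G := [set x | (v%:E <= mu (refl K x))%E].
have Gd x : G x -> d <= dot x x.
  by move=> Gx; rewrite leNgt; apply/negP => xd; apply: H; exists x => //; rewrite vE.
have [r r0 rK] := compact_coord_bounded cK.
have Gr x : G x -> forall i, `|x ord0 i| <= 2 * r.
  move=> Gx i; have [y Ky] : refl K x !=set0.
    apply: contrapT => /nonemptyPn e; move: Gx; rewrite /G/= e measure0 lee_fin.
    by rewrite leNgt v0.
  have := rK _ (refl_half cvK Ky) i; rewrite mxE normrM ger0_norm ?invr_ge0//; lra.
(* Coordinates on [G] are at most [2 * r] in absolute value, so [D] bounds squared distances within
   [G], and squared norms as well. *)
pose D := (n%:R * (4 * r) ^+ 2 : R).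
have D0 : 0 < D by rewrite mulr_gt0 ?ltr0n// exprn_gt0// mulr_gt0.
have dotD x y : G x -> G y -> dot (x - y) (x - y) <= D.
  move=> Gx Gy; rewrite /D -[X in _ <= X%:R * _]card_ord mulr_natl -sumr_const.
  apply: ler_sum => i _; rewrite !mxE -expr2 -[leRHS]ger0_norm ?sqr_ge0// -[leLHS]ger0_norm ?sqr_ge0//.
  rewrite !normrX ler_pXn2r ?nnegrE// (ger0_norm (_ : 0 <= 4 * r)); last by lra.
  by apply: le_trans (ler_normB _ _) _; have := Gr _ Gx i; have := Gr _ Gy i; lra.
have [g0 _ Gg0] := refl_measure_halfspace n1 cK cvK K0 (int0 0) (ltr01 : 0 < 1 :> R).
rewrite vE in Gg0.
pose A := [set dot x x | x in G].
have A0 : A !=set0 by exists (dot g0 g0), g0.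
have lA : has_lbound A by exists d => _ [x Gx <-]; exact: Gd.
pose s := inf A.
have ds : d <= s by apply: lb_le_inf => // _ [x Gx <-]; exact: Gd.
have s0 : 0 < s by exact: lt_le_trans ds.
have GD x : G x -> dot x x <= D.
  move=> Gx.
  rewrite /D -[X in _ <= X%:R * _]card_ord mulr_natl -sumr_const.
  apply: ler_sum => i _; rewrite -expr2 -[leRHS]ger0_norm ?sqr_ge0// -[leLHS]ger0_norm ?sqr_ge0//.
  rewrite !normrX ler_pXn2r ?nnegrE// (ger0_norm (_ : 0 <= 4 * r)); last by lra.
  by apply: le_trans (Gr _ Gx i) _; lra.
clearbody D.
have step x : G x -> s <= dot x x - (dot x x) ^+ 2 / (4 * D).
  move=> Gx; set m := dot x x.
  have m0 : 0 < m by apply: lt_le_trans (Gd _ Gx).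
  (* This slack yields an admissible [y] with [dot x y <= m / 2]. *)
  have m4 : 0 < m / 4 by rewrite divr_gt0.
  have [y xy] := refl_measure_halfspace n1 cK cvK K0 (int0 x) m4.
  rewrite vE => Gy.
  (* Minimizer of [m - t * m + t ^+ 2 * D], with minimum [m - m ^+ 2 / (4 * D)]; it is at most 1
     because [m <= D]. *)
  pose t := m / (2 * D).
  have t0 : 0 <= t by apply: divr_ge0; [exact: ltW|rewrite mulr_ge0// ltW].
  have t1 : t <= 1.
    have D2 : 0 < 2 * D by rewrite mulr_gt0.
    have := GD _ Gx; rewrite /t ler_pdivrMr// -/m; lra.
  pose z := t *: y + (1 - t) *: x.
  have Gz : G z by exact: refl_measure_quasiconcave.
  have zE : z = x + t *: (y - x).
    by rewrite /z scalerBl scale1r scalerBr addrCA.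
  have sz : s <= dot z z by apply: ge_inf => //; exists z.
  apply: (le_trans sz); rewrite zE dotDZ dotBr -/m.
  have := dotD _ _ Gy Gx; set q := dot (y - x) _ => qD.
  have q0 : 0 <= q by exact: dot_ge0.
  have e1 : 2 * t * (dot x y - m) <= - (t * m).
    have : 2 * t * (dot x y - m) <= 2 * t * (- (m / 2)).
      by apply: ler_wpM2l; [rewrite mulr_ge0|lra].
    by lra.
  have e2 : t ^+ 2 * q <= t ^+ 2 * D by apply: ler_wpM2l; rewrite ?sqr_ge0//; lra.
  have e3 : m - t * m + t ^+ 2 * D = m - m ^+ 2 / (4 * D).
    by rewrite /t; field; rewrite gt_eqF.
  by rewrite -e3; lra.
(* All admissible squared norms are at least [s], so [step] raises this lower bound by a fixed
   positive amount, contradicting that [s] is the infimum. *)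
have : s + s ^+ 2 / (4 * D) <= s.
  rewrite {3}/s; apply: lb_le_inf => // _ [x Gx <-].
  have := step _ Gx; have sx : s <= dot x x by apply: ge_inf => //; exists x.
  have : s ^+ 2 / (4 * D) <= dot x x ^+ 2 / (4 * D).
    by apply: ler_wpM2r; rewrite ?invr_ge0 ?mulr_ge0 ?(ltW D0)// ler_pXn2r ?nnegrE ?dot_ge0// ltW.
  by lra.
apply/negP; rewrite -ltNge ltrDl divr_gt0 ?exprn_gt0// mulr_gt0//.
Qed.

(** The measure of [refl K x] is upper semicontinuous at 0: the unions [F m] over tails of a
    sequence tending to 0 decrease to a subset of [refl K 0], because [K] is closed, and continuity
    from above carries the lower bound to the limit. *)
Lemma refl0_measure K : (1 <= n)%N -> compact K -> cvx K -> (0 < mu K)%E ->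
  (forall th, \int[mu]_(x in K) dot th x = 0) ->
  ((2 ^- (6 * n))%:E * mu K <= mu (refl K 0))%E.
Proof.
move=> n1 cK cvK K0 int0.
have mK := compact_measurable_rV cK.
have /choice[x xP] (k : nat) : exists x : 'rV[R]_n, dot x x < k.+1%:R^-1 /\
    ((2 ^- (6 * n))%:E * mu K <= mu (refl K x))%E.
  have k0 : 0 < k.+1%:R^-1 :> R by rewrite invr_gt0.
  by have [x] := refl_measure_near0 n1 cK cvK K0 int0 k0; exists x.
pose F m := \bigcup_(k in [set k | (m <= k)%N]) refl K (x k).
have mF m : measurable (F m) by apply: bigcup_measurable => k _; exact: measurable_refl.
have FK m : F m `<=` K by move=> y [k _ []].
have F0 : (mu (F 0%N) < +oo)%E.
  by rewrite (le_lt_trans _ (compact_measure_lty cK))// le_measure ?inE//; exact: FK.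
have ndF : nonincreasing_seq F.
  move=> a b ab; apply/subsetPset => y [k bk ky]; exists k => //=.
  exact: leq_trans bk.
have mcap : measurable (\bigcap_m F m) by exact: bigcapT_measurable.
have cvF := nonincreasing_cvg_mu F0 mF mcap ndF.
apply: (@le_trans _ _ (mu (\bigcap_m F m))).
  apply: (cvge_to_ge cvF) => //.
  apply: nearW => m /=; have [_ h] := xP m; apply: le_trans h _.
  apply: le_measure; rewrite ?inE//; first exact: measurable_refl.
  by apply: (bigcup_sup (i := m)) => /=.
apply: le_measure; rewrite ?inE//; first exact: measurable_refl.
move=> y Fy; split; first exact: FK (Fy 0%N _).
rewrite /= sub0r; apply: contrapT => nKy.
have oK : open (~` K) by apply: closed_openC; exact: compact_closed_rV.
have /nbhs_ballP[e /= e0 eK] : nbhs (- y) (~` K) by exact: open_nbhs_nbhs.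
pose m := Num.truncn (e ^+ 2)^-1.
have me : m.+1%:R^-1 < e ^+ 2.
  rewrite invf_plt ?posrE ?exprn_gt0//.
  by rewrite -truncn_lt_nat ?invr_ge0 ?exprn_ge0// ltW.
have [k mk [Ky Kxy]] := Fy m I.
apply: (eK (x k - y)) => //; split => // i j; rewrite (ord1 i) /ball/= !mxE.
rewrite (_ : - y 0 j - (x k 0 j - y 0 j) = - x k 0 j); last by ring.
rewrite normrN.
have [xk _] := xP k.
rewrite -(@ltr_pXn2r _ 2)// ?nnegrE ?(ltW e0)// -normrX ger0_norm ?sqr_ge0//.
apply: le_lt_trans (coord_sqr_le_dot _ _) _; apply: lt_trans xk _.
apply: le_lt_trans me; rewrite lef_pV2 ?posrE// ler_nat ltnS.
exact: mk.
Qed.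
End central_symmetry.

(** * Determinants and positive definite matrices *)

Section second_moment_algebra.
Context {R : realType}.

(** The rank decomposition of [u] has an invertible 1 by 1 left factor, which is [c]. It serves to
    move a nonzero vector onto the first coordinate axis. *)
Lemma row_completion n (u : 'rV[R]_n.+1) : u != 0 ->
  exists c, exists2 N : 'M[R]_n.+1, N \in unitmx & c != 0 /\ u = c *: row ord0 N.
Proof.
move=> u0; have r1 : \rank u = 1%N by rewrite rank_rV u0.
exists (col_ebase u 0 0), (row_ebase u); first exact: row_ebase_unit.
have uE := mulmx_ebase u; rewrite r1 in uE.
split.
  by have := col_ebase_unit u; rewrite unitmxE unitfE det_mx11.
rewrite -[LHS]uE {1}[col_ebase u]mx11_scalar mul_scalar_mx -scalemxAl; congr (_ *: _).
rewrite rowE; congr (_ *m _); apply/matrixP => i j; rewrite !mxE !ord1.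
by rewrite eqxx andbT eq_sym.
Qed.

(* Pick [y1] with [y1 M^-1 y1^T >= n], change basis so that [y1] is a multiple of the
   first basis vector, and apply induction to the other coordinates. *)
Lemma greedy_det n (S : set 'rV[R]_n) (M : 'M[R]_n) :
  (forall B : 'M[R]_n, exists2 y, S y & \tr (B *m M) <= (y *m B *m y^T) 0 0) ->
  0 < \det M ->
  exists2 Y : 'M[R]_n, (forall i, S (row i Y)) & n`!%:R * \det M <= (\det Y) ^+ 2.
Proof.
elim: n S M => [|n IHn] S M SM M0.
  by exists 1%:M; [case|rewrite !det_mx00 mulr1 expr1n].
have uM : M \in unitmx by rewrite unitmxE unitfE gt_eqF.
have [y1 Sy1] := SM (invmx M).
rewrite mulVmx// mxtrace1 => y1M.
have y10 : y1 != 0.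
  by apply/eqP => y10; move: y1M; rewrite y10 !mul0mx mxE lern0.
have [c [N uN [c0 y1E]]] := row_completion y10.
pose Q := invmx N.
have uQ : Q \in unitmx by rewrite unitmx_inv.
have y1Q : y1 *m Q = c *: delta_mx 0 ord0.
  by rewrite y1E rowE -scalemxAl -mulmxA mulmxV// mulmx1.
pose M' : 'M[R]_(1 + n) := Q^T *m M *m Q.
have uM' : M' \in unitmx by rewrite !unitmx_mul unitmx_tr uQ uM.
have detM' : \det M' = \det M * \det Q ^+ 2.
  by rewrite /M' !det_mulmx det_tr; ring.
have iM' : invmx M' = N *m invmx M *m N^T.
  apply: (can_inj (mulKmx uM')); rewrite mulmxV// /M'.
  rewrite !mulmxA -[_ *m Q *m N]mulmxA mulVmx// mulmx1.
  by rewrite -[_ *m M *m _]mulmxA mulmxV// mulmx1 -trmx_mul mulmxV// trmx1.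
have c2 : n.+1%:R <= c ^+ 2 * invmx M' ord0 ord0.
  apply: (le_trans y1M); rewrite y1E iM'.
  rewrite linearZ/= -scalemxAr -!scalemxAl scalerA mxE -expr2.
  rewrite !rowE trmx_mul.
  rewrite (_ : _ *m _ *m _ *m _ = delta_mx 0 ord0 *m (N *m invmx M *m N^T) *m (delta_mx (0 : 'I_1) (ord0 : 'I_n.+1))^T); last by rewrite !mulmxA.
  by rewrite -rowE trmx_delta -colE !mxE.
(* Cramer's rule. With [c2] it gives [c ^+ 2 * \det (drsubmx M') >= n.+1%:R * \det M']: each round
   supplies one factor of the factorial. *)
have detdr : \det (drsubmx M') = invmx M' ord0 ord0 * \det M'.
  rewrite /invmx uM' [in RHS]mxE mulrC mulrA mulfV ?mul1r; last first.
    by rewrite -unitfE -unitmxE.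
  rewrite mxE /cofactor expr0 mul1r; congr (\det _).
  move: (M') => A; apply/matrixP => i j; rewrite !mxE.
  by congr (fun_of_matrix A _ _); exact/val_inj.
have iM'0 : 0 < invmx M' ord0 ord0.
  have := lt_le_trans (ltr0Sn R n) c2.
  by rewrite pmulr_rgt0// exprn_even_gt0.
have detM'0 : 0 < \det M'.
  rewrite detM' mulr_gt0// exprn_even_gt0//=.
  by rewrite -unitfE -unitmxE.
pose tail (y : 'rV[R]_n.+1) := rsubmx (y *m Q : 'rV[R]_(1 + n)).
have [||Y'' SY'' detY''] := IHn [set tail y | y in S] (drsubmx M').
- move=> B.
  (* A form on the remaining coordinates, padded by zeros, is a form on the whole space; this is how
     the hypothesis on [S] passes to the projected set. *)
  pose B' : 'M[R]_(1 + n) := block_mx 0 0 0 B.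
  have [y Sy yB] := SM (Q *m B' *m Q^T).
  exists (tail y); first by exists y.
  have -> : \tr (B *m drsubmx M') = \tr (Q *m B' *m Q^T *m M).
    have -> : \tr (Q *m B' *m Q^T *m M) = \tr (B' *m M').
      by rewrite /M' -!(mulmxA Q) mxtrace_mulC !mulmxA.
    rewrite -[M' in RHS]submxK /B' mulmx_block !mul0mx !add0r mxtrace_block mxtrace0 add0r.
    by [].
  apply: (le_trans yB).
  rewrite (_ : y *m _ *m _ = (y *m Q) *m B' *m (y *m Q)^T); last by rewrite trmx_mul !mulmxA.
  rewrite -[y *m Q](@hsubmxK _ 1 1 n) /B'.
  rewrite [X in X *m _](@mul_row_block _ 1 1 n 1 n) !mulmx0 !add0r.
  by rewrite (@tr_row_mx _ 1 1 n) (@mul_row_col _ 1 1 n) mul0mx add0r.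
- by rewrite detdr mulr_gt0.
have /choice[y yP] (i : 'I_n) : exists y, S y /\ tail y = row i Y''.
  by have [y Sy yE] := SY'' i; exists y.
pose Y : 'M[R]_(1 + n) := col_mx y1 (\matrix_i y i).
exists Y.
  move=> i; have [j ->|->] := unliftP ord0 i.
    rewrite (_ : row _ _ = y j); first by have [] := yP j.
    apply/rowP => k; rewrite mxE (_ : lift ord0 j = rshift 1 j); last exact/val_inj.
    by rewrite (@col_mxEd _ 1 n) mxE.
  rewrite (_ : row _ _ = y1)//.
  apply/rowP => k; rewrite -[RHS](@col_mxEu _ 1 n _ y1 (\matrix_i y i) 0 k) [LHS]mxE.
  by congr (fun_of_matrix _ _ _); exact/val_inj.
have YQ : Y *m Q = block_mx c%:M 0 (lsubmx (\matrix_i y i *m Q : 'M[R]_(n, 1 + n))) Y''.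
  rewrite [LHS](@mul_col_mx _ 1 n) block_mxEv; congr col_mx.
    rewrite y1Q; apply/rowP => k.
    have [j ->|->] := unliftP ord0 k.
      rewrite (_ : lift ord0 j = rshift 1 j); last exact/val_inj.
      by rewrite (@row_mxEr _ 1 1 n) !mxE mulr0.
    transitivity (row_mx (c%:M : 'M[R]_1) (0 : 'rV[R]_n) 0 (lshift n (0 : 'I_1))).
      by rewrite (@row_mxEl _ 1 1 n) !mxE mulr1.
    by congr (fun_of_matrix _ _ _); exact/val_inj.
  have e : rsubmx (\matrix_i y i *m Q : 'M[R]_(n, 1 + n)) = Y''.
    apply/row_matrixP => i; have [_ <-] := yP i.
    rewrite /tail; apply/rowP => k; rewrite !mxE; apply: eq_bigr => l _.
    by rewrite !mxE.
  rewrite -[X in row_mx _ X]e; exact: esym (@hsubmxK _ n 1 n _).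
have detYQ : \det Y * \det Q = c * \det Y''.
  by rewrite -det_mulmx YQ (@det_lblock _ 1 n) det_scalar1.
have Q2 : 0 < \det Q ^+ 2 by rewrite exprn_even_gt0//= -unitfE -unitmxE.
rewrite -(ler_pM2r Q2) -exprMn detYQ exprMn.
apply: (@le_trans _ _ (c ^+ 2 * (n`!%:R * \det (drsubmx M')))); last first.
  by rewrite ler_pM2l// exprn_even_gt0.
rewrite -mulrA -detM' detdr factS natrM.
rewrite [leRHS](_ : _ = (c ^+ 2 * invmx M' ord0 ord0) * (n`!%:R * \det M')); last by ring.
by rewrite -[leLHS]mulrA ler_wpM2r// mulr_ge0// ltW.
Qed.

(** Completing the square: the Schur complement [D'] of the corner [a] gives the minimum of the form
    over its first coordinate, hence is again positive definite, and its factor is bordered by a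
    column with top entry [sqrt a]. *)
Lemma cholesky n (M : 'M[R]_n) : M^T = M ->
  (forall x : 'rV[R]_n, x != 0 -> 0 < (x *m M *m x^T) 0 0) ->
  exists2 P : 'M[R]_n, P \in unitmx & M = P *m P^T.
Proof.
elim: n M => [|n IHn] M symM posM.
  by exists 1%:M; [exact: unitmx1|apply/matrixP => -[]].
pose M1 : 'M[R]_(1 + n) := M.
pose a := M1 0 0; pose b := ursubmx M1; pose D := drsubmx M1.
have ME : M1 = block_mx a%:M b b^T D.
  rewrite -[LHS]submxK; congr block_mx.
    by rewrite [LHS]mx11_scalar /a; move: (M1) => A; rewrite !mxE; congr (fun_of_matrix A _ _)%:M; exact/val_inj.
  by rewrite /b trmx_ursub; congr (dlsubmx _); rewrite /M1 symM.
have symD : D^T = D by rewrite /D trmx_drsub; congr drsubmx; rewrite /M1 symM.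
have quadM (t : R) (x : 'rV[R]_n) : let z : 'rV[R]_(1 + n) := row_mx t%:M x in
    (z *m M1 *m z^T) 0 0 = t ^+ 2 * a + 2 * t * (b *m x^T) 0 0 + (x *m D *m x^T) 0 0.
  move=> z; rewrite ME /z (@mul_row_block _ 1 1 n 1 n) (@tr_row_mx _ 1 1 n) (@mul_row_col _ 1 1 n).
  rewrite tr_scalar_mx !mulmxDl !mul_scalar_mx mul_mx_scalar.
  rewrite -!scalemxAl.
  have -> : x *m b^T = (b *m x^T)^T by rewrite trmx_mul trmxK.
  by rewrite !mul_mx_scalar; rewrite !mxE /=; rewrite !mulr1n; ring.
have a0 : 0 < a.
  have z0 : (row_mx (1%:M : 'M[R]_1) (0 : 'rV[R]_n) : 'rV[R]_n.+1) != 0.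
    apply/eqP => z0; have := f_equal (@lsubmx _ 1 1 n) z0; rewrite row_mxKl => /matrixP/(_ 0 0).
    by rewrite !mxE eqxx => /eqP; rewrite oner_eq0.
  have := posM _ z0; rewrite (quadM 1 0) trmx0 !mulmx0 !mxE.
  by rewrite expr1n mul1r mulr0 !addr0.
pose D' := D - a^-1 *: (b^T *m b).
have symD' : D'^T = D'.
  by rewrite /D' linearB/= symD linearZ/= trmx_mul trmxK.
have posD' (x : 'rV[R]_n) : x != 0 -> 0 < (x *m D' *m x^T) 0 0.
  move=> x0; pose t := - (b *m x^T) 0 0 / a.
  have z0 : (row_mx (t%:M : 'M[R]_1) x : 'rV[R]_n.+1) != 0.
    apply: contra x0 => /eqP z0; apply/eqP.
    have := f_equal (@rsubmx _ 1 1 n) z0; rewrite row_mxKr => ->.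
    by apply/rowP => k; rewrite !mxE.
  have := posM _ z0; rewrite (quadM t x).
  have -> : (x *m D' *m x^T) 0 0 = (x *m D *m x^T) 0 0 - a^-1 * (b *m x^T) 0 0 ^+ 2.
    rewrite /D' mulmxBr mulmxBl -scalemxAr -scalemxAl.
    rewrite (_ : x *m (b^T *m b) *m x^T = (b *m x^T)^T *m (b *m x^T)); last by rewrite trmx_mul trmxK !mulmxA.
    move: (b *m x^T) => e; move: (x *m D *m x^T) => f.
    by rewrite !mxE big_ord1 mxE expr2.
  by congr (0 < _); rewrite /t; field; rewrite gt_eqF.
have [P' uP' D'E] := IHn D' symD' posD'.
pose sa := Num.sqrt a.
have sa0 : 0 < sa by rewrite sqrtr_gt0.
exists (block_mx sa%:M 0 (sa^-1 *: b^T) P' : 'M[R]_(1 + n)).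
  rewrite unitmxE (@det_lblock _ 1 n) det_scalar1 unitfE mulf_neq0 ?(gt_eqF sa0)//.
  by rewrite -unitfE -unitmxE.
rewrite -[LHS]/M1 ME (@tr_block_mx _ 1 n 1 n) (@mulmx_block _ 1 n 1 n 1 n).
rewrite trmx0 tr_scalar_mx linearZ/= trmxK !mul0mx !mulmx0 !addr0.
have e1 : sa%:M *m sa%:M = a%:M :> 'M[R]_1 by rewrite -scalar_mxM -expr2 sqr_sqrtr// ltW.
have e2 : sa%:M *m (sa^-1 *: b) = b by rewrite mul_scalar_mx scalerA mulfV ?scale1r// gt_eqF.
have e3 : sa^-1 *: b^T *m sa%:M = b^T by rewrite mul_mx_scalar scalerA mulfV ?scale1r// gt_eqF.
have e4 : sa^-1 *: b^T *m (sa^-1 *: b) + P' *m P'^T = D.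
  rewrite -D'E /D' -scalemxAl -scalemxAr scalerA -invfM -expr2 sqr_sqrtr ?ltW//.
  by rewrite addrC subrK.
by rewrite e1 e2 e3 e4.
Qed.
End second_moment_algebra.

(** * The matrix of second moments *)

Section second_moment.
Context {R : realType}.
Notation mu n := (@lebesgue_measure_rV R n).
Notation leb := (@lebesgue_measure R).

Lemma ge0_integral_rVS n (f : 'rV[R]_n.+1 -> \bar R) : measurable_fun setT f ->
  (forall x, (0 <= f x)%E) ->
  (\int[mu n.+1]_x f x = \int[leb]_s \int[mu n]_y f (cons_rV (s, y)))%E.
Proof.
move=> mf f0.
have -> : (\int[mu n.+1]_x f x = \int[leb \x mu n]_p f (cons_rV p))%E.
  rewrite -[RHS](ge0_integral_pushforward (@measurable_cons_rV R n) _ (D := setT))//.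
rewrite fubini_tonelli1//.
exact: (measurableT_comp mf (@measurable_cons_rV R n)).
Qed.

(** The Gaussian integral, that is, the square root of pi; being independent of the dimension, it
    may enter bounds to the power [n]. *)
Definition gauss_mass : R := fine (\int[leb]_t (expR (- t ^+ 2))%:E).

Lemma gauss_massE : (\int[leb]_t (expR (- t ^+ 2))%:E = gauss_mass%:E)%E.
Proof.
rewrite fineK//; apply: integrable_fin_num => //.
exact: integrableT_gauss.
Qed.

Lemma measurable_expNdot n (T : 'M[R]_n) :
  measurable_fun setT (fun x : 'rV[R]_n => (expR (- dot (x *m T) (x *m T)))%:E).
Proof.
apply/measurable_EFinP; apply: measurableT_comp => //.
apply: measurable_funN.
rewrite /dot; apply: measurable_sum => i.
by apply: measurable_funM; apply: (measurableT_comp (measurable_coord_rV i) (measurable_mulmx T)).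
Qed.

Lemma integral_gauss_rV n :
  (\int[mu n]_x (expR (- dot x x))%:E = (gauss_mass ^+ n)%:E)%E.
Proof.
have mg k : measurable_fun setT (fun x : 'rV[R]_k => (expR (- dot x x))%:E).
  have := measurable_expNdot (1%:M : 'M[R]_k).
  by under eq_fun do rewrite mulmx1.
elim: n => [|n IHn].
  have -> : (fun x : 'rV[R]_0 => (expR (- dot x x))%:E) = cst 1%E.
    by apply/funext => x; rewrite /dot big_ord0 oppr0 expR0.
  rewrite integral_cst//= diracE mem_set// mul1e expr0.
  by [].
rewrite ge0_integral_rVS//.
transitivity (\int[leb]_s ((expR (- s ^+ 2))%:E * (gauss_mass ^+ n)%:E))%E.
  apply: eq_integral => s _; rewrite -IHn -ge0_integralZl//; last exact: mg.
  apply: eq_integral => y _; rewrite -EFinM -expRD -opprD; congr (expR (- _))%:E.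
  rewrite /dot big_ord_recl cons_rV0 expr2; congr (_ + _).
  by apply: eq_bigr => i _; rewrite !cons_rVS.
rewrite ge0_integralZr//.
- by rewrite gauss_massE -EFinM exprS.
- apply/measurable_EFinP; exact: measurable_gauss_fun.
- rewrite lee_fin exprn_ge0// fine_ge0// integral_ge0//.
Qed.

(** A linear change of variables turns the hyperplane into a box with one side reduced to a
    point. *)
Lemma measure_hyperplane n (u : 'rV[R]_n) : u != 0 -> mu n [set x | dot u x = 0] = 0%E.
Proof.
case: n u => [|n] u u0; first by rewrite (thinmx0 u) eqxx in u0.
have [c [N uN [c0 uE]]] := row_completion u0.
have uNT : N^T \in unitmx by rewrite unitmx_tr.
have [_ _ sc] := scales_mulmx uNT.
pose A0 (i : 'I_n.+1) : set R := if i == ord0 then [set 0] else setT.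
have mA0 i : measurable (A0 i) by rewrite /A0; case: ifP.
have -> : [set x | dot u x = 0] = (fun x => x *m N^T) @^-1` [set x | forall i, A0 i (x ord0 i)].
  have key x : dot u x = c * (x *m N^T) ord0 ord0.
    rewrite uE dotC dotZr; congr (_ * _).
    by rewrite mxE; apply: eq_bigr => i _; rewrite !mxE.
  apply/seteqP; split => x /=.
    rewrite key => /eqP; rewrite mulf_eq0 (negbTE c0)/= => /eqP x0 i.
    by rewrite /A0; case: eqP => // ->.
  by move=> /(_ ord0); rewrite /A0 eqxx key => /= ->; rewrite mulr0.
rewrite [LHS]sc; last exact: measurable_forall_rV.
rewrite [X in (_ * X)%E](lebesgue_measure_rV_rect mA0) big_ord_recl /A0 eqxx.
by rewrite lebesgue_measure_set1 mul0e mule0.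
Qed.

Section moments.
Variables (n : nat) (K : set 'rV[R]_n).
Hypotheses (cK : compact K) (K0 : (0 < mu n K)%E).

Let V := fine (mu n K).
Let mK := compact_measurable_rV cK.
Let finK : mu n K \is a fin_num.
Proof. by rewrite ge0_fin_numE//; exact: compact_measure_lty. Qed.
Let V0 : 0 < V. Proof. by rewrite fine_gt0// K0 -ge0_fin_numE. Qed.

(** A double sum rather than a matrix product, so that it can be integrated term by term. *)
Definition quad (B : 'M[R]_n) (x : 'rV[R]_n) : R := \sum_i \sum_j B i j * (x ord0 i * x ord0 j).

Lemma quadE B x : quad B x = (x *m B *m x^T) 0 0.
Proof.
rewrite mxE /quad exchange_big; apply: eq_bigr => j _.
rewrite mxE big_distrl/=; apply: eq_bigr => i _.
by rewrite mxE mulrAC mulrC.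
Qed.

Lemma dotE (x y : 'rV[R]_n) : dot x y = (x *m y^T) 0 0.
Proof. by rewrite mxE; apply: eq_bigr => i _; rewrite mxE. Qed.

Lemma continuous_quad B : continuous (quad B).
Proof.
apply: continuous_sum => i; apply: continuous_sum => j.
apply: continuous_funM; first exact: continuous_cst.
by apply: continuous_funM; exact: continuous_coord.
Qed.

Definition second_moment : 'M[R]_n :=
  \matrix_(i, j) (V^-1 * \int[mu n]_(x in K) (x ord0 i * x ord0 j)).

Lemma second_moment_sym : second_moment^T = second_moment.
Proof.
apply/matrixP => i j; rewrite !mxE; congr (_ * _).
by apply: eq_Rintegral => x _; rewrite mulrC.
Qed.

Lemma Rintegral_quad B : \int[mu n]_(x in K) quad B x = V * \tr (B *m second_moment).
Proof.
have cxy i j : continuous (fun x : 'rV[R]_n => x ord0 i * x ord0 j).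
  by apply: continuous_funM; exact: continuous_coord.
have cB i j : continuous (fun x : 'rV[R]_n => B i j * (x ord0 i * x ord0 j)).
  by apply: continuous_funM; [exact: continuous_cst|exact: cxy].
rewrite Rintegral_sum//; last by move=> i; apply: integrable_compact => //; exact: continuous_sum.
rewrite /mxtrace big_distrr/=; apply: eq_bigr => i _.
rewrite Rintegral_sum//; last by move=> j; exact: integrable_compact.
rewrite mxE big_distrr/=; apply: eq_bigr => j _.
rewrite RintegralZl//; last exact: integrable_compact.
rewrite mxE mulrCA; congr (_ * _); rewrite mulrA mulfV ?gt_eqF// mul1r.
by apply: eq_Rintegral => x _; rewrite mulrC.
Qed.

(** The trace is the mean of [quad B] over [K], hence at most its maximum. This supplies the
    hypothesis of [greedy_det]. *)
Lemma second_moment_le_quad B : exists2 y, K y & \tr (B *m second_moment) <= quad B y.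
Proof.
have Kn0 : K !=set0.
  by apply: contrapT => /nonemptyPn e; move: K0; rewrite e measure0 ltxx.
have [y /set_mem Ky ymax] : exists2 y, y \in K & forall x, x \in K -> quad B x <= quad B y.
  by apply: compact_EVT_max => //; apply: continuous_subspaceT; exact: continuous_quad.
exists y => //; rewrite -(ler_pM2l V0) -Rintegral_quad mulrC -Rintegral_cst//.
apply: le_Rintegral => //.
- by apply: integrable_compact => //; exact: continuous_quad.
- by apply: integrable_compact => //; exact: continuous_cst.
- by move=> x Kx; apply: ymax; exact: mem_set.
Qed.

(** The form is the mean of [dot x z ^+ 2] over [z] in [K]; if it vanished, [K] would lie in a
    hyperplane up to a null set and have measure 0. *)
Lemma second_moment_pos (x : 'rV[R]_n) : x != 0 -> 0 < (x *m second_moment *m x^T) 0 0.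
Proof.
move=> x0.
pose B : 'M[R]_n := x^T *m x.
have -> : (x *m second_moment *m x^T) 0 0 = V^-1 * \int[mu n]_(z in K) (dot x z ^+ 2).
  have -> : \int[mu n]_(z in K) (dot x z ^+ 2) = \int[mu n]_(z in K) quad B z.
    apply: eq_Rintegral => z _; rewrite quadE /B !mulmxA.
    rewrite -[z *m x^T *m x *m z^T]mulmxA mxE big_ord1 expr2; congr (_ * _).
      by rewrite mxE dotC; apply: eq_bigr => i _; rewrite mxE.
    by rewrite mxE; apply: eq_bigr => i _; rewrite mxE.
  rewrite Rintegral_quad mulrA mulVf ?gt_eqF// mul1r /B -(mulmxA x^T) (mxtrace_mulC x^T).
  by rewrite /mxtrace big_ord1.
rewrite mulr_gt0 ?invr_gt0// lt_neqAle; apply/andP; split; last first.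
  by apply: Rintegral_ge0 => z _; exact: sqr_ge0.
apply/negP => /eqP i0.
have cd : continuous (fun z => dot x z ^+ 2).
  by under eq_fun do rewrite expr2; apply: continuous_funM; exact: continuous_dot.
have intd := integrable_compact cK cd.
have : (\int[mu n]_(z in K) `|(dot x z ^+ 2)%:E| = 0)%E.
  under eq_integral do rewrite gee0_abs ?lee_fin ?sqr_ge0//.
  have := i0; rewrite /Rintegral => /esym i1.
  rewrite -(fineK (integrable_fin_num mK intd)).
  by rewrite i1.
have mfd : measurable_fun K (fun z => (dot x z ^+ 2)%:E).
  by have /integrableP[] := intd.
move=> /(ae_eq_integral_abs (mu n) mK mfd).
move=> [Z [mZ Z0 KZ]].
have mH : measurable [set z | dot x z = 0].
  have := continuous_measurable_rV (@continuous_dot R n x) measurableT (measurable_set1 0).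
  by rewrite setTI.
have : (mu n K <= mu n Z + mu n [set z | dot x z = 0%R])%E.
  apply: le_trans (measureU2 _ mZ mH).
  apply: le_measure; rewrite ?inE//; first exact: measurableU.
  move=> z Kz; have [xz|xz] := eqVneq (dot x z) 0; [by right|left].
  apply: KZ => /= h; have := h Kz; case => /eqP; rewrite sqrf_eq0 (negbTE xz)//.
by rewrite Z0 measure_hyperplane// adde0 leNgt K0.
Qed.

(* Compare the integral of exp (- x M^-1 x^T) over R^n with the lower bound on K
   given by the tangent line of the convex function exp at the mean value -n. *)
Lemma measure_le_det P : P \in unitmx -> second_moment = P *m P^T ->
  V <= (expR 1 * gauss_mass) ^+ n * `|\det P|.
Proof.
(* The inverse transpose of [P]: the squared norm of [x *m T] is then the form of the inverse of
   [second_moment]. *)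
move=> uP ME; pose T := (invmx P)^T.
have uT : T \in unitmx by rewrite unitmx_tr unitmx_inv.
pose N := invmx second_moment.
have uM : second_moment \in unitmx by rewrite ME unitmx_mul uP unitmx_tr uP.
have qE x : dot (x *m T) (x *m T) = quad N x.
  have -> : N = T *m T^T.
    apply: (can_inj (mulKmx uM)); rewrite mulmxV// ME /T trmxK !mulmxA.
    by rewrite -(mulmxA P) -trmx_mul mulVmx// trmx1 mulmx1 mulmxV.
  rewrite quadE (_ : x *m _ *m x^T = (x *m T) *m (x *m T)^T); last by rewrite trmx_mul !mulmxA.
  exact: dotE.
have intq : \int[mu n]_(x in K) quad N x = V * n%:R.
  by rewrite Rintegral_quad mulVmx// mxtrace1.
have := scales_mulmx uT => sc.
have gT := ge0_integral_scales sc (f := fun x => (expR (- dot x x))%:E) _ _.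
have {gT} : (\int[mu n]_x (expR (- dot (x *m T) (x *m T)))%:E = (`|\det P| * gauss_mass ^+ n)%:E)%E.
  rewrite gT; first last.
  - by move=> x; rewrite lee_fin expR_ge0.
  - have := measurable_expNdot (1%:M : 'M[R]_n).
    by under eq_fun do rewrite mulmx1.
  by rewrite integral_gauss_rV -EFinM /T det_tr det_inv normfV invrK.
move=> gT.
have cq := continuous_quad (B := N).
have cNq : continuous (fun x => - quad N x) by move=> x; exact: (continuousN (cq x)).
have ce : continuous (fun x => expR (- quad N x)).
  by move=> x; apply: (@continuous_comp _ _ _ (fun x => - quad N x) expR); [exact: cNq|exact: continuous_expR].
have cd : continuous (fun x => (1 + n%:R) - quad N x).
  by apply: continuous_funD => //; exact: continuous_cst.
have : (\int[mu n]_(x in K) (expR (- quad N x))%:E <= (`|\det P| * gauss_mass ^+ n)%:E)%E.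
  rewrite -gT; under [leRHS]eq_integral do rewrite qE.
  apply: ge0_subset_integral => //.
  - have := measurable_expNdot T.
    by under eq_fun do rewrite qE.
have inte := integrable_compact cK ce.
rewrite -(fineK (integrable_fin_num mK inte)) lee_fin -/(Rintegral _ _ _) => ub.
have lo : \int[mu n]_(x in K) (expR (- n%:R) * ((1 + n%:R) - quad N x)) <= \int[mu n]_(x in K) expR (- quad N x).
  apply: le_Rintegral => //.
  - apply: integrable_compact => //; apply: continuous_funM; [exact: continuous_cst|exact: cd].
  - move=> x _.
    rewrite (_ : - quad N x = - n%:R + (n%:R - quad N x)); last by ring.
    rewrite expRD ler_wpM2l ?expR_ge0//.
    by apply: le_trans (expR_ge1Dx _); lra.
have := le_trans lo ub.
rewrite RintegralZl//; last exact: integrable_compact.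
rewrite RintegralB//; last first.
- exact: integrable_compact.
- by apply: integrable_compact => //; exact: continuous_cst.
rewrite Rintegral_cst// intq -/V.
(* The mean of [quad N] is exactly [n], so the tangent line integrates to [V] times its constant
   factor [expR (- n%:R)]. *)
rewrite (_ : _ - _ = V); last by ring.
rewrite expRN -ler_pdivlMl ?invr_gt0 ?expR_gt0// invrK.
by rewrite exprMn -expRM_natl mulr1 mulrCA mulrC.
Qed.
End moments.
End second_moment.

(** * Simplices centered at the origin *)

Section simplices.
Context {R : realType}.
Notation mu n := (@lebesgue_measure_rV R n).

Lemma convex_setE (V : lmodType R) (A : set V) :
  convex_set (A : set (convex_lmodType V)) <-> cvx A.
Proof.
split=> [cA x y t t0 t1 Ax Ay|cA x y l /set_mem Ax /set_mem Ay].
  have := cA x y (Itv01 t0 t1) (mem_set Ax) (mem_set Ay).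
  by move/set_mem.
by apply/mem_set; exact: (cA x y l%:num (ge0 l) (le1 l) Ax Ay).
Qed.

Lemma cvx_sum (V : lmodType R) (A : set V) m (p : 'I_m -> V) (l : 'I_m -> R) :
  cvx A -> (forall i, A (p i)) -> (forall i, 0 <= l i) -> \sum_i l i = 1 ->
  A (\sum_i l i *: p i).
Proof.
move=> cA; elim: m p l => [|m IHm] p l Ap l0.
  by rewrite big_ord0 => /esym/eqP; rewrite oner_eq0.
rewrite !big_ord_recl; set t := \sum_(i < m) _ => lt1.
have t0 : 0 <= t by apply: sumr_ge0.
have [t00|tn0] := eqVneq t 0.
  have lz i : l (lift ord0 i) = 0.
    have := psumr_eq0P (F := fun i => l (lift ord0 i)) (P := xpredT).
    by move=> /(_ (fun i _ => l0 _) t00 i isT).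
  rewrite big1 ?addr0; last by move=> i _; rewrite lz scale0r.
  by move: lt1; rewrite t00 addr0 => ->; rewrite scale1r.
have -> : \sum_(i < m) l (lift ord0 i) *: p (lift ord0 i) =
    (1 - l ord0) *: \sum_(i < m) (l (lift ord0 i) / t) *: p (lift ord0 i).
  rewrite -lt1 addrC addKr scaler_sumr; apply: eq_bigr => i _.
  by rewrite scalerA mulrCA mulfV// mulr1.
apply: cA => //; first by rewrite -lt1 lerDl.
apply: IHm => //; first by move=> i; rewrite divr_ge0.
by rewrite -mulr_suml mulfV.
Qed.

Section centered_simplex.
Variables (n : nat) (V : 'M[R]_n).
Hypotheses (n0 : (0 < n)%N) (uV : V \in unitmx).

(** The vertex of index 0 is forced by the requirement that all vertices sum to 0, which centers the
    simplex at the origin. *)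
Definition vertex (i : 'I_n.+1) : 'rV[R]_n :=
  if unlift ord0 i is Some j then row j V else - \sum_j row j V.

Lemma vertex0 : vertex ord0 = - \sum_j row j V.
Proof. by rewrite /vertex unlift_none. Qed.

Lemma vertexS j : vertex (lift ord0 j) = row j V.
Proof. by rewrite /vertex liftK. Qed.

Lemma sum_vertex (a : 'I_n.+1 -> R) :
  \sum_i a i *: vertex i = (\row_j (a (lift ord0 j) - a ord0)) *m V.
Proof.
rewrite big_ord_recl vertex0 scalerN scaler_sumr -sumrN -big_split/= mulmx_sum_row.
by apply: eq_bigr => j _; rewrite vertexS mxE scalerBl addrC.
Qed.

Lemma vertex_affinely_independent : affinely_independent vertex.
Proof.
move=> a a0; rewrite sum_vertex => aV.
have : \row_j (a (lift ord0 j) - a ord0) = 0.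
  by apply: (can_inj (mulmxK uV)); rewrite aV mul0mx.
move=> /rowP ar.
have aE i : a i = a ord0.
  have [j ->|-> //] := unliftP ord0 i.
  by have := ar j; rewrite !mxE => /eqP; rewrite subr_eq0 => /eqP.
have : a ord0 *+ n.+1 = 0.
  by rewrite -a0 (eq_bigr (fun=> a ord0))// sumr_const card_ord.
by move=> /eqP; rewrite mulrn_eq0/= => /eqP z i; rewrite aE.
Qed.

Let S := convex_hull (range vertex).

(* Barycentric coordinate of [vertex 0] at the point with coordinates [u] in the
   basis of rows of [V]; that of [vertex (lift 0 i)] is then [u_i + lam0 u]. *)
Definition lam0 (u : 'rV[R]_n) : R := (1 - \sum_i u ord0 i) / n.+1%:R.

Definition in_simplex (u : 'rV[R]_n) := 0 <= lam0 u /\ forall i, 0 <= u ord0 i + lam0 u.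

Let nn0 : n.+1%:R != 0 :> R. Proof. by rewrite pnatr_eq0. Qed.

Lemma lam0_conv t (x y : 'rV[R]_n) :
  lam0 (t *: x + (1 - t) *: y) = t * lam0 x + (1 - t) * lam0 y.
Proof.
rewrite /lam0; have -> : \sum_i (t *: x + (1 - t) *: y) ord0 i =
   t * \sum_i x ord0 i + (1 - t) * \sum_i y ord0 i.
  by rewrite !mulr_sumr -big_split/=; apply: eq_bigr => i _; rewrite !mxE.
by field; rewrite addrC natr1.
Qed.

Lemma in_simplex_cvx : cvx in_simplex.
Proof.
move=> x y t t0 t1 [x0 xi] [y0 yi]; split.
  by rewrite lam0_conv addr_ge0// mulr_ge0// subr_ge0.
move=> i; rewrite lam0_conv !mxE.
rewrite [leRHS](_ : _ = t * (x ord0 i + lam0 x) + (1 - t) * (y ord0 i + lam0 y)); last by ring.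
by rewrite addr_ge0// mulr_ge0// subr_ge0.
Qed.

(** Inequalities on barycentric coordinates replace the intersection that defines the hull;
    measurability, volume and symmetries are read off from them. *)
Lemma convex_hull_vertexE : S = (fun x => x *m invmx V) @^-1` in_simplex.
Proof.
apply/seteqP; split.
  apply: smallest_sub => /=.
    apply/convex_setE => x y t t0 t1 /= Sx Sy.
    by rewrite mulmxDl -!scalemxAl; exact: in_simplex_cvx.
  move=> _ [i _ <-] /=.
  have [j ->|->] := unliftP ord0 i.
    rewrite vertexS rowE mulmxK//.
    have l0 : lam0 (delta_mx 0 j) = 0.
      rewrite /lam0 (bigD1 j)//= big1 ?mxE ?eqxx ?addr0 ?subrr ?mul0r//.
      by move=> k kj; rewrite mxE (negbTE kj) andbF.
    split; first by rewrite l0.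
    by move=> k; rewrite l0 addr0 mxE ler0n.
  have -> : vertex ord0 *m invmx V = const_mx (-1).
    have -> : vertex ord0 = const_mx (-1) *m V.
      rewrite vertex0 mulmx_sum_row -sumrN; apply: eq_bigr => j _.
      by rewrite mxE scaleN1r.
    by rewrite mulmxK.
  have l1 : lam0 (const_mx (-1)) = 1.
    rewrite /lam0; under eq_bigr do rewrite mxE.
    by rewrite sumr_const card_ord mulNrn opprK -mulrS mulfV.
  by split; rewrite l1 // => k; rewrite mxE addNr.
move=> x [/= x0 xi].
set u := x *m invmx V in x0 xi.
pose l (i : 'I_n.+1) := if unlift ord0 i is Some j then u ord0 j + lam0 u else lam0 u.
have l00 : l ord0 = lam0 u by rewrite /l unlift_none.
have lS j : l (lift ord0 j) = u ord0 j + lam0 u by rewrite /l liftK.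
have -> : x = \sum_i l i *: vertex i.
  rewrite sum_vertex -[LHS](mulmxKV uV); congr (_ *m _).
  by apply/rowP => j; rewrite [RHS]mxE lS l00 addrK.
move=> A [/convex_setE cA AA]; apply: cvx_sum => //.
- by move=> i; apply: AA; exists i.
- by move=> i; have [j ->|->] := unliftP ord0 i; rewrite ?lS ?l00.
- rewrite big_ord_recl l00; under eq_bigr do rewrite lS.
  rewrite big_split/= sumr_const card_ord addrCA -mulrS.
  by rewrite -[_ *+ _]mulr_natr /lam0 divfK// addrC subrK.
Qed.

Lemma continuous_lam0 : continuous lam0.
Proof.
apply: continuous_funM; last exact: continuous_cst.
apply: continuous_funD; first exact: continuous_cst.
have cs : continuous (fun u : 'rV[R]_n => \sum_i u ord0 i).
  by apply: continuous_sum => i; exact: continuous_coord.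
by move=> x; exact: (continuousN (cs x)).
Qed.

Lemma measurable_in_simplex : measurable in_simplex.
Proof.
have mge (f : 'rV[R]_n -> R) : continuous f -> measurable [set u | 0 <= f u].
  move=> cf; have := continuous_measurable_rV cf measurableT (measurable_itv `[0, +oo[).
  rewrite setTI (_ : f @^-1` _ = [set u | 0 <= f u])//.
  by apply/seteqP; split => u /=; rewrite in_itv/= andbT.
rewrite (_ : in_simplex = [set u | 0 <= lam0 u] `&`
   \bigcap_(i in [set: 'I_n]) [set u : 'rV[R]_n | 0 <= u ord0 i + lam0 u]).
  apply: measurableI; first exact: mge continuous_lam0.
  apply: fin_bigcap_measurable => // i _; apply: mge.
  by apply: continuous_funD; [exact: continuous_coord|exact: continuous_lam0].
apply/seteqP; split => u [u0 ui]; split => //; first by move=> i _; exact: ui.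
by move=> i; exact: ui.
Qed.

Lemma measurable_hull : measurable S.
Proof.
rewrite convex_hull_vertexE -[X in measurable X]setTI.
by apply: measurable_mulmx => //; exact: measurable_in_simplex.
Qed.

(** In the basis of rows of [V] the simplex contains a cube of side [1 / n], on which the
    coordinates sum to at most 1. The exact factor [(n + 1) / n!] is larger only by a power
    [C ^ n]. *)
Lemma hull_measure_ge : ((`|\det V| / n%:R ^+ n)%:E <= mu n S)%E.
Proof.
have uiV : invmx V \in unitmx by rewrite unitmx_inv.
have [_ _ sc] := scales_mulmx uiV.
rewrite convex_hull_vertexE [leRHS]sc; last exact: measurable_in_simplex.
rewrite det_inv normfV invrK EFinM; apply: lee_wpmul2l; first by rewrite lee_fin.
have n0' : 0 < n%:R :> R by rewrite ltr0n.
apply: (@le_trans _ _ (mu n [set u | forall i, `[0, n%:R^-1]%classic (u ord0 i)])).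
  rewrite (@lebesgue_measure_rV_rect _ _ (fun=> `[0, n%:R^-1]%classic))//.
  rewrite (eq_bigr (fun=> (n%:R^-1)%:E)); last first.
    by move=> i _; rewrite leb_itv_bnd ?subr0// invr_ge0 ltW.
  have prodE (a : R) k : (\prod_(i < k) a%:E = (a ^+ k)%:E)%E.
    by elim: k => [|k IHk]; rewrite ?big_ord0 ?expr0// big_ord_recl IHk exprS.
  rewrite prodE.
  by rewrite exprVn.
apply: le_measure; rewrite ?inE.
- exact: (measurable_forall_rV (A := fun=> `[0, n%:R^-1]%classic)).
- exact: measurable_in_simplex.
move=> u /= ui.
have l0 : 0 <= lam0 u.
  rewrite divr_ge0// subr_ge0 (le_trans (ler_sum _ (G := fun=> n%:R^-1) _))//.
    by move=> i _; have := ui i; rewrite in_itv/= => /andP[].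
  by rewrite sumr_const card_ord -[_ *+ _]mulr_natl mulfV// gt_eqF.
split => // i; rewrite addr_ge0//.
by have := ui i; rewrite in_itv/= => /andP[].
Qed.

(* Coordinates of the linear involution exchanging [vertex 0] and [vertex (lift 0 i)]. *)
Definition swap_mx (i : 'I_n) : 'M[R]_n :=
  1%:M - delta_mx i ord0 *m (const_mx 1 + delta_mx ord0 i : 'rV[R]_n).

Lemma swap_mxE i (u : 'rV[R]_n) k :
  (u *m swap_mx i) ord0 k = u ord0 k - u ord0 i * (1 + (k == i)%:R).
Proof.
rewrite /swap_mx mulmxBr mulmx1 mulmxA -colE mxE; congr (_ + _).
by rewrite !mxE big_ord1 !mxE eqxx.
Qed.

Lemma swap_mxK i : swap_mx i *m swap_mx i = 1%:M.
Proof.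
apply/row_matrixP => j; rewrite !rowE mulmxA mulmx1; apply/rowP => k.
by rewrite !swap_mxE eqxx /=; ring.
Qed.

Lemma lam0_swap i u : lam0 (u *m swap_mx i) = u ord0 i + lam0 u.
Proof.
rewrite /lam0; under eq_bigr do rewrite swap_mxE.
have e : \sum_(k < n) (k == i)%:R = 1 :> R.
  by rewrite (bigD1 i)//= eqxx big1 ?addr0// => k /negbTE ->.
rewrite sumrB -mulr_sumr big_split/= sumr_const card_ord e.
by field; rewrite addrC natr1.
Qed.

Lemma in_simplex_swap i u : in_simplex u -> in_simplex (u *m swap_mx i).
Proof.
move=> [u0 ui]; split; first by rewrite lam0_swap.
move=> k; rewrite lam0_swap swap_mxE; have [->|ki] := eqVneq k i.
  by rewrite /= [leRHS](_ : _ = lam0 u)//; ring.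
by rewrite /= [leRHS](_ : _ = u ord0 k + lam0 u)//; ring.
Qed.

(* The barycenter is fixed by all the involutions [swap_mx i]. *)
Lemma hull_barycenter K : compact K -> S `<=` K -> barycenter S = 0.
Proof.
move=> cK SK; pose b : 'rV[R]_n := \row_i \int[mu n]_(x in S) x ord0 i.
have mS := measurable_hull.
(* Integrability on [S] is inherited from the compact set [K] around it. *)
have intS (f : 'rV[R]_n -> R) : continuous f -> (mu n).-integrable S (EFin \o f).
  move=> cf; apply: (@integrableS _ _ _ _ K) => //; first exact: compact_measurable_rV.
  exact: integrable_compact.
suff b0 : b = 0 by rewrite /barycenter -/b b0 scaler0.
suff : b *m invmx V = 0 by move=> bV; rewrite -[b](mulmxKV uV) bV mul0mx.
apply/rowP => i; rewrite [RHS]mxE.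
(* The swap in standard coordinates; as an involution it has determinant of absolute value 1 and
   preserves the measure. *)
pose T := invmx V *m swap_mx i *m V.
have TT : T *m T = 1%:M.
  rewrite /T -!mulmxA (mulmxA V) mulmxV// mul1mx (mulmxA (swap_mx i)) swap_mxK mul1mx.
  by rewrite mulVmx.
have uT : T \in unitmx by have [] := mulmx1_unit TT.
have detT : `|\det T| = 1.
  have : `|\det T| ^+ 2 = 1 by rewrite -normrX expr2 -det_mulmx TT det1 normr1.
  by move=> /eqP; rewrite sqrp_eq1// => /eqP.
have ST : (fun x => x *m T) @^-1` S = S.
  have sub x : S x -> S (x *m T).
    rewrite convex_hull_vertexE /= => Sx.
    by rewrite /T !mulmxA mulmxK//; exact: in_simplex_swap.
  apply/seteqP; split => x /=; last exact: sub.
  by move=> /sub; rewrite -mulmxA TT mulmx1.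
have [mT _ scT] := scales_mulmx uT.
have intT (f : 'rV[R]_n -> R) : continuous f -> continuous (fun x : 'rV[R]_n => f (x *m T)) ->
    \int[mu n]_(x in S) f (x *m T) = \int[mu n]_(x in S) f x.
  move=> cf cfT; rewrite /Rintegral; congr fine.
  have mf : measurable_fun setT (EFin \o f).
    by apply/measurable_EFinP; exact: continuous_measurable_rV.
  have ifT : (mu n).-integrable ((fun x => x *m T) @^-1` S) ((EFin \o f) \o (fun x => x *m T)).
    by rewrite ST; exact: intS cfT.
  have := integral_pushforward mT mf ifT mS; rewrite ST => <-.
  pose m' : measure _ R := measure_function_pushforward__canonical__measure_function_Measure (mu n) mT.
  apply: (@eq_measure_integral _ _ _ _ (mu n) m') => A mA _.
  by rewrite [LHS]scT// detT invr1 mul1e.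
have bT : b *m T = b.
  apply/rowP => j; rewrite [RHS]mxE -intT; last 2 first.
  - exact: continuous_coord.
  - have -> : (fun x : 'rV[R]_n => (x *m T) ord0 j) = (fun x => \sum_k x ord0 k * T k j).
      by apply/funext => x; rewrite mxE.
    apply: continuous_sum => k; apply: continuous_funM; [exact: continuous_coord|exact: continuous_cst].
  rewrite mxE.
  have ck k : continuous (fun x : 'rV[R]_n => x ord0 k * T k j).
    by apply: continuous_funM; [exact: continuous_coord|exact: continuous_cst].
  transitivity (\int[mu n]_(x in S) \sum_k (x ord0 k * T k j)); last first.
    by apply: eq_Rintegral => x _; rewrite mxE.
  rewrite Rintegral_sum//; last by move=> k; exact: intS.
  apply: eq_bigr => k _; rewrite mxE mulrC -RintegralZl//; last first.
    by apply: intS; exact: continuous_coord.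
  by apply: eq_Rintegral => x _; rewrite mulrC.
have : (b *m invmx V) *m swap_mx i = b *m invmx V.
  by rewrite -[in RHS]bT /T !mulmxA mulmxK.
(* Coordinate [i] of the fixed vector is sent to its opposite, hence vanishes. *)
move=> /rowP/(_ i); rewrite swap_mxE eqxx /=.
by set w := (b *m invmx V) ord0 i; rewrite -/w => h; change (w = 0); lra.
Qed.
End centered_simplex.
End simplices.

(** * Factorial bound, cyclic differences and the final constant *)

Section final.
Context {R : realType}.
Notation mu n := (@lebesgue_measure_rV R n).

(** Each factor of the falling factorial of [2 n] of length [n] is at least [n]; that product is a
    binomial coefficient times [n!], and the coefficient is a single term of the expansion of
    [(1 + 1) ^ (2 n)]. *)
Lemma expnn_le_fact n : (n ^ n <= 4 ^ n * n`!)%N.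
Proof.
have h1 : (n ^ n <= (n + n) ^_ n)%N.
  suff H : forall k, (k <= n)%N -> (n ^ k <= (n + n) ^_ k)%N by exact: H.
  elim=> [//|k IHk kn]; rewrite expnSr ffactnSr.
  by apply: leq_mul; [exact: IHk (ltnW kn)|rewrite -addnBA ?leq_addr// ltnW].
apply: (leq_trans h1); rewrite -bin_ffact leq_mul2r; apply/orP; right.
rewrite -(expnM 2 2) mul2n -addnn -[X in (_ <= X ^ _)%N]/(1 + 1)%N.
rewrite expnDn (bigD1 (inord n))//=; last first.
rewrite inordK ?ltnS ?leq_addr// !exp1n !muln1.
exact: leq_addr.
Qed.

(** Row [i] is [e_i - e_(i-1)], and row 0 is [e_0] alone: the unitriangular matrix of successive
    differences starting from 0. *)
Lemma diff_mx_det n : \det (\matrix_(i < n, j < n) ((i == j)%:R - (i == j.+1 :> nat)%:R) : 'M[R]_n) = 1.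
Proof.
rewrite det_trig.
  rewrite big1// => i _; rewrite !mxE eqxx.
  by rewrite -[(i == i.+1 :> nat)]/(i == i.+1 :> nat) ltn_eqF// subr0.
apply/is_trig_mxP => i j ij; rewrite mxE.
rewrite (_ : (i == j) = false); last by apply/negbTE; rewrite neq_ltn ij.
by rewrite (_ : (i == j.+1 :> nat) = false) ?subr0//; apply/negbTE; rewrite neq_ltn ltnS (ltnW ij).
Qed.

Lemma centered_simplex_in n (K0 : set 'rV[R]_n) (Y : 'M[R]_n) : (0 < n)%N ->
  cvx K0 -> (forall x, K0 x -> K0 (- x)) -> (forall i, K0 (row i Y)) ->
  \det Y != 0 ->
  exists V : 'M[R]_n, [/\ V \in unitmx, `|\det V| = 2^-1 ^+ n * `|\det Y| &
    forall i, K0 (vertex V i)].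
Proof.
case: n K0 Y => // n K0 Y _ cK0 symK0 K0Y Y0.
have half x y : K0 x -> K0 y -> K0 (2^-1 *: (x - y)).
  move=> Kx Ky; have := cK0 x (- y) 2^-1 _ _ Kx (symK0 _ Ky).
  rewrite (_ : 1 - 2^-1 = 2^-1 :> R); last by lra.
  by rewrite -scalerDr; apply; lra.
have K00 : K0 0.
  by have := half _ _ (K0Y ord0) (K0Y ord0); rewrite subrr scaler0.
pose U : 'M[R]_n.+1 := \matrix_(i, j) ((i == j)%:R - (i == j.+1 :> nat)%:R).
pose V : 'M[R]_n.+1 := 2^-1 *: (U *m Y).
have detV : \det V = 2^-1 ^+ n.+1 * \det Y.
  by rewrite /V detZ det_mulmx diff_mx_det mul1r.
exists V; split.
- by rewrite unitmxE unitfE detV mulf_neq0// expf_neq0// invr_neq0.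
- by rewrite detV normrM normrX ger0_norm ?invr_ge0.
(* Indices are shifted by one: [w 0 = 0], and [w k.+1] is row [k] of [Y]. *)
pose w (k : nat) : 'rV[R]_n.+1 := if k is k'.+1 then row (inord k') Y else 0.
have Kw k : K0 (w k) by case: k => [|k] /=.
have rV i : row i V = 2^-1 *: (w i.+1 - w i).
  apply/rowP => j; rewrite /w /= inord_val !mxE; congr (_ * _).
  under eq_bigr do rewrite mxE mulrBl.
  rewrite sumrB; congr (_ - _).
    rewrite (bigD1 i)//= eqxx mul1r big1 ?addr0// => k ki.
    by rewrite eq_sym (negbTE ki) mul0r.
  case: i => -[|i] /= lin.
    by rewrite mxE big1// => k _; rewrite mul0r.
  rewrite mxE (bigD1 (inord i))//= inordK ?(ltnW lin)// eqxx mul1r big1 ?addr0// => k ki.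
  rewrite (_ : (i.+1 == k.+1) = false) ?mul0r//.
  by apply: contraNF ki => /eqP[ik]; rewrite ik inord_val.
move=> i; have [j ->|->] := unliftP ord0 i.
  by rewrite vertexS rV; exact: half.
(* The sum telescopes, so the remaining vertex is half of [w 0 - w n.+1], the difference that closes
   the cycle. *)
rewrite vertex0 (eq_bigr (fun j : 'I_n.+1 => 2^-1 *: (w j.+1 - w j))); last by move=> j _; exact: rV.
rewrite -scaler_sumr -scalerN -(big_mkord xpredT (fun j => w j.+1 - w j)) telescope_sumr//.
by rewrite opprB; exact: half.
Qed.

End final.

Theorem theorem1p4 (R : realType) :
  exists c : R, 0 < c /\
    forall (n : nat) (K : set 'rV[R]_n),
      (1 <= n)%N -> convex_body K -> barycenter K = 0 ->
      exists S : set 'rV[R]_n,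
        [/\ simplex S, S `<=` K, barycenter S = 0 &
            (vol S / vol K) `^ (n%:R^-1) >= c / Num.sqrt n%:R].
Proof.
have g0 : 0 <= gauss_mass :> R by rewrite fine_ge0// integral_ge0.
(* The added 1 makes the constant visibly positive. *)
pose e1 : R := expR 1 * gauss_mass + 1.
have e10 : 0 < e1 by rewrite ltr_wpDl// mulr_ge0// expR_ge0.
(* One factor 2 comes from halving the differences, the other from the square root of the 4 in
   [expnn_le_fact], [2 ^+ 6] from the symmetrization and [e1] from the Gaussian bound. *)
pose c : R := (2 * 2 * 2 ^+ 6 * e1)^-1.
have c0 : 0 < c by rewrite invr_gt0 !mulr_gt0// exprn_gt0.
exists c; split=> // n K n1 [cK cvK [z Kz]] bK.
have {}cvK : cvx K by apply/convex_setE.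
have mK := compact_measurable_rV cK.
have finK : lebesgue_measure_rV n K \is a fin_num by rewrite ge0_fin_numE//; exact: compact_measure_lty.
have K0 : (0 < lebesgue_measure_rV n K)%E.
  have /nbhs_ballP[e /= e0 eK] : nbhs z K := Kz.
  apply: (@lt_le_trans _ _ (lebesgue_measure_rV n [set x | forall i, `[z ord0 i, z ord0 i + e / 2]%classic (x ord0 i)])).
    rewrite (@lebesgue_measure_rV_rect _ _ (fun i => `[z ord0 i, z ord0 i + e / 2]%classic))//.
    elim/big_ind: _ => [//|x y x0 y0|i _]; first exact: mule_gt0.
    rewrite leb_itv_bnd; last lra.
    by rewrite lte_fin; lra.
  apply: le_measure; rewrite ?inE//.
    exact: (measurable_forall_rV (A := fun i => `[z ord0 i, z ord0 i + e / 2]%classic)).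
  move=> x /= xz; apply: eK; split => // i j; rewrite (ord1 i) /ball/=.
  have := xz j; rewrite /= in_itv/= => /andP[? ?].
  by rewrite ltr_norml; apply/andP; split; lra.
pose VK := fine (lebesgue_measure_rV n K).
have VK0 : 0 < VK by rewrite fine_gt0// K0 -ge0_fin_numE.
have int0 th : \int[lebesgue_measure_rV n]_(x in K) dot th x = 0.
  move: bK; rewrite /barycenter => /eqP; rewrite scaler_eq0 invr_eq0 /vol gt_eqF//= => /eqP b0.
  rewrite Rintegral_sum//; last first.
    move=> i; apply: integrable_compact => //.
    by apply: continuous_funM; [exact: continuous_cst|exact: continuous_coord].
  rewrite big1// => i _; rewrite RintegralZl//; last first.
    by apply: integrable_compact => //; exact: continuous_coord.
  by have := congr1 (fun v : 'rV[R]_n => v ord0 i) b0; rewrite !mxE => ->; rewrite mulr0.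
pose L := refl K 0.
have LE : L = K `&` [set y | K (- y)].
  by rewrite /L /refl; apply/seteqP; split => y /=; rewrite sub0r.
have cvL : cvx L by exact: refl_cvx.
have symL x : L x -> L (- x) by rewrite LE => -[Kx Knx]; split => //=; rewrite opprK.
have cL : compact L.
  apply: (subclosed_compact _ cK); last by move=> x [].
  rewrite LE; apply: closedI; first exact: compact_closed_rV.
  apply: (@closed_comp _ _ (fun y : 'rV[R]_n => - y)); last exact: compact_closed_rV.
  by move=> x _; exact: opp_continuous.
have muL := refl0_measure n1 cK cvK K0 int0.
have L0 : (0 < lebesgue_measure_rV n L)%E.
  by apply: lt_le_trans muL; rewrite mule_gt0// lte_fin invr_gt0 exprn_gt0.
pose VL := fine (lebesgue_measure_rV n L).
have finL : lebesgue_measure_rV n L \is a fin_num by rewrite ge0_fin_numE//; exact: compact_measure_lty.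
have VKL : 2 ^- (6 * n) * VK <= VL by rewrite -lee_fin EFinM !fineK.
have [P uP ME] := cholesky (second_moment_sym L) (second_moment_pos cL L0).
have VLP := measure_le_det cL L0 uP ME.
have detM : \det (second_moment L) = \det P ^+ 2 by rewrite ME det_mulmx det_tr.
have P0 : \det P != 0 by rewrite -unitfE -unitmxE.
have [||Y LY detY] := @greedy_det R n L (second_moment L).
- move=> B; have [y Ly By] := second_moment_le_quad cL L0 B.
  by exists y => //; rewrite -quadE.
- by rewrite detM exprn_even_gt0.
have nf0 : 0 < n`!%:R :> R by rewrite ltr0n fact_gt0.
have Y0 : \det Y != 0.
  rewrite -sqrf_eq0 gt_eqF//; apply: lt_le_trans detY.
  by rewrite mulr_gt0// detM exprn_even_gt0.
have [V [uV detV LV]] := centered_simplex_in n1 cvL symL LY Y0.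
pose S := convex_hull (range (vertex V)).
have SL : S `<=` L.
  apply: smallest_sub; first exact/convex_setE.
  by move=> _ [i _ <-].
have SK : S `<=` K by move=> x /SL [].
exists S; split => //.
- by exists (vertex V) => //; exact: vertex_affinely_independent.
- exact: hull_barycenter cK SK.
have vS := hull_measure_ge n1 uV; rewrite -/S in vS.
have finS : lebesgue_measure_rV n S \is a fin_num.
  rewrite ge0_fin_numE// (le_lt_trans _ (compact_measure_lty cK))// le_measure ?inE//.
  exact: measurable_hull.
have {}vS : `|\det V| / n%:R ^+ n <= vol S by rewrite -lee_fin fineK.
have n0R : 0 < n%:R :> R by rewrite ltr0n.
pose s := Num.sqrt (n%:R : R).
have s0 : 0 < s by rewrite sqrtr_gt0.
have s2 : s ^+ 2 = n%:R by rewrite sqr_sqrtr// ltW.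
have dP0 : 0 < `|\det P| by rewrite normr_gt0.
(* Square root of [greedy_det], with [n!] replaced by its lower bound [(n / 4) ^ n]. *)
have dY : (s / 2) ^+ n * `|\det P| <= `|\det Y|.
  rewrite -(@ler_pXn2r _ 2)// ?nnegrE ?mulr_ge0 ?exprn_ge0// ?divr_ge0 ?(ltW s0)//.
  rewrite exprMn -exprM mulnC exprM expr_div_n s2.
  rewrite -!normrX !ger0_norm ?sqr_ge0//; apply: le_trans detY; rewrite detM.
  rewrite ler_wpM2r ?sqr_ge0// expr_div_n ler_pdivrMr ?exprn_gt0//.
  rewrite (_ : (2 ^+ 2) ^+ n = (4 ^ n)%N%:R); last first.
    by rewrite natrX; congr (_ ^+ _); rewrite -natrX.
  by rewrite -natrX -natrM ler_nat mulnC expnn_le_fact.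
have key : (c / s) ^+ n <= vol S / vol K.
  rewrite ler_pdivlMr//; apply: le_trans vS.
  rewrite ler_pdivlMr ?exprn_gt0// detV.
  have h1 : VK <= 2 ^+ (6 * n) * (e1 ^+ n * `|\det P|).
    rewrite -ler_pdivrMl ?exprn_gt0//; apply: (le_trans VKL); apply: (le_trans VLP).
    by rewrite ler_wpM2r// lerXn2r ?nnegrE ?mulr_ge0 ?expR_ge0 ?(ltW e10)// lerDl.
  apply: (@le_trans _ _ (2^-1 ^+ n * ((s / 2) ^+ n * `|\det P|))); last first.
    by rewrite ler_wpM2l// exprn_ge0// invr_ge0.
  rewrite -mulrA mulrCA -/VK.
  apply: le_trans (_ : VK * ((c / s) ^+ n * n%:R ^+ n) <= _).
    exact: lexx.
  (* The rate appears here: the loss [n ^ n] in the simplex volume against the gain [s ^ n] in the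
     determinant leaves [1 / s] per dimension, as [s ^+ 2 = n]. *)
  rewrite -exprMn (_ : c / s * n%:R = c * s); last first.
    by rewrite -s2 expr2 mulrA divfK// gt_eqF.
  apply: (@le_trans _ _ (2 ^+ (6 * n) * (e1 ^+ n * `|\det P|) * (c * s) ^+ n)).
    by rewrite ler_wpM2r// exprn_ge0// mulr_ge0 ?(ltW c0) ?(ltW s0).
  rewrite exprM !mulrA -!exprMn.
  rewrite mulrAC -exprMn ler_wpM2r// le_eqVlt; apply/orP; left; apply/eqP.
  congr (_ ^+ _); rewrite /c; field.
  by rewrite gt_eqF.
have cs0 : 0 <= c / s by rewrite divr_ge0 ?(ltW c0) ?(ltW s0).
have -> : c / s = ((c / s) ^+ n) `^ (n%:R^-1).
  by rewrite -powR_mulrn// -powRrM mulfV ?gt_eqF// powRr1.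
apply: ge0_ler_powR => //; rewrite ?nnegrE ?exprn_ge0//.
by apply: le_trans key; rewrite exprn_ge0.
Qed.
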